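(* Let $A=\begin{pmatrix}1&1&1&1\\0&1&3&4\end{pmatrix}$ and let $M=\mathbb{D}(H_A((1,2)))$ be the holonomic dual of the GKZ-system $H_A(\beta)$ with $\beta=(1,2)$. Then $M$ is not a GKZ-system in the classical sense. That is, $M\not\cong H_B(\beta')$ (as a left module over the Weyl algebra in four variables) for any integer matrix $B$ with four columns satisfying the standing assumptions and any parameter $\beta'$.
   Context: Standing assumptions on an integer $d\times n$ matrix $A$ (here $n=4$; the same is required of $B$, with its own number of rows): it has distinct columns $\mathbf a_1,\dots,\mathbf a_n$, $\mathbb{Z}A=\mathbb{Z}^d$, and it is pointed: the semigroup $\mathbb{N}A$ has no units besides the origin. $D_A=\mathbb{C}\langle x_1,\dots,x_n,\partial_1,\dots,\partial_n\rangle$ is the Weyl algebra, $R_A=\mathbb{C}[\partial_1,\dots,\partial_n]$. $I_A\subseteq R_A$ is the toric ideal, the kernel of $R_A\to\mathbb{C}[t_1^{\pm1},\dots,t_d^{\pm1}]$, $\partial_j\mapsto t^{\mathbf a_j}$. For $1\le i\le d$ put $E_i=\sum_{j=1}^n a_{i,j}x_j\partial_j$. The (classical, or proper) GKZ-system with parameter $\beta\in\mathbb{C}^d$ is the left $D_A$-module $H_A(\beta)=D_A/D_A\cdot(I_A,\{E_i-\beta_i\}_{i=1}^d)$. The standard transposition $\tau: x^{\mathbf u}\partial^{\mathbf v}\mapsto(-\partial)^{\mathbf v}x^{\mathbf u}$ on $D_A$ induces an equivalence between left and right $D_A$-modules. The holonomic dual of a holonomic left $D_A$-module $N$ is $\mathbb{D}(N)=\tau(\operatorname{Ext}^n_{D_A}(N,D_A))$.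 *)

(* Defs.v *)
From HB Require Import structures.
From mathcomp Require Import all_boot all_algebra.
From mathcomp Require Import fraction generic_quotient ring_quotient finmap.
From mathcomp Require Import boolp.
From mathcomp Require monalg.
From mathcomp Require Import mpoly.

Set Implicit Arguments.
Unset Strict Implicit.
Unset Printing Implicit Defensive.

Import GRing.Theory.
Local Open Scope ring_scope.
Local Open Scope quotient_scope.

(* Right modules over a ring D are represented as [lmodType D^c].             *)

Definition lmod_iso (D : nzRingType) (U V : lmodType D) : Prop :=
  exists f : {linear U -> V}, bijective f.

Section Submodule.
Context (D : nzRingType) (V : lmodType D) (S : V -> Prop).

Inductive spanned : V -> Prop :=
| spanned0 : spanned 0
| spannedZD a x y : S x -> spanned y -> spanned (a *: x + y).

Definition lspan : {pred V} := fun x => `[< spanned x >].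

Lemma lspan_submod_closed : submod_closed lspan.
Proof.
split=> [|a x y /asboolP sx /asboolP sy]; first exact/asboolP/spanned0.
apply/asboolP; elim: sx => [|b u v Su _ IH].
  by rewrite scaler0 add0r.
by rewrite scalerDr scalerA -addrA; exact: spannedZD.
Qed.

HB.instance Definition _ := GRing.isSubmodClosed.Build D V lspan
  lspan_submod_closed.

Definition lquot := Quotient.quot lspan.

HB.instance Definition _ := GRing.Zmodule.on lquot.
HB.instance Definition _ := ZmodQuotient.on lquot.

Definition lquot_scale (a : D) := lift_op1 lquot (fun x => a *: x).

Lemma pi_lquot_scale a : {morph \pi_lquot : x / a *: x >-> lquot_scale a x}.
Proof.
move=> x; unlock lquot_scale; apply/eqP.
by rewrite -Quotient.idealrBE -scalerBr rpredZ // Quotient.idealrBE reprK.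
Qed.


Let scaleE := pi_lquot_scale.

Lemma lquot_scaleA a b (u : lquot) :
  lquot_scale a (lquot_scale b u) = lquot_scale (a * b) u.
Proof. by rewrite -[u]reprK -!scaleE scalerA. Qed.

Lemma lquot_scale1 : left_id 1 lquot_scale.
Proof. by move=> u; rewrite -[u]reprK -!scaleE scale1r. Qed.

Lemma lquot_scaleDr : right_distributive lquot_scale +%R.
Proof.
move=> a u v; rewrite -[u]reprK -[v]reprK -(raddfD \pi_lquot).
by rewrite -!scaleE scalerDr raddfD.
Qed.

Lemma lquot_scaleDl u : {morph lquot_scale^~ u : a b / a + b}.
Proof. by move=> a b; rewrite -[u]reprK -!scaleE scalerDl raddfD. Qed.

HB.instance Definition _ := GRing.Zmodule_isLmodule.Build D lquot
  lquot_scaleA lquot_scale1 lquot_scaleDr lquot_scaleDl.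

End Submodule.

Section Kernel.
Context (D : nzRingType) (U V : lmodType D) (f : {linear U -> V}).

Definition lker_pred : {pred U} := fun x => f x == 0.

Lemma lker_submod_closed : submod_closed lker_pred.
Proof.
split=> [|a x y]; rewrite !unfold_in ?linear0 // linearP.
by move=> /eqP-> /eqP->; rewrite scaler0 addr0.
Qed.

HB.instance Definition _ := GRing.isSubmodClosed.Build D U lker_pred
  lker_submod_closed.

Record lker := LKer { lker_val : U; _ : lker_val \in lker_pred }.

HB.instance Definition _ := [isSub for lker_val].
HB.instance Definition _ := [Choice of lker by <:].
HB.instance Definition _ := [SubChoice_isSubZmodule of lker by <:].
HB.instance Definition _ := [SubZmodule_isSubLmodule of lker by <:].

Lemma lker_val_linear : linear lker_val.
Proof. by move=> a x y; rewrite -[lker_val]/val linearP. Qed.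

HB.instance Definition _ := GRing.isLinear.Build D lker U *:%R lker_val
  lker_val_linear.

Lemma lkerP (x : lker) : f (lker_val x) = 0.
Proof. by case: x => x /= /eqP. Qed.
End Kernel.

(* Hom_D(U, D) as a right D-module: (f a)(u) = f(u) a. *)
Section RightDual.
Context (D : nzRingType) (U : lmodType D).

Definition rdual := {linear U -> D^o}.

HB.instance Definition _ := gen_eqMixin rdual.
HB.instance Definition _ := gen_choiceMixin rdual.

Lemma rdualP (f g : rdual) : f =1 g -> f = g.
Proof.
case: f g => [f [[f1] [f2]]] [g [[g1] [g2]]] /= /funext efg.
by subst g; congr (GRing.Linear.Pack (GRing.Linear.Class _ _)); congr (_ _);
   apply: Prop_irrelevance.
Qed.

Definition rdual_zero : rdual := [the {linear U -> D^o} of \0%R].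
Definition rdual_opp (f : rdual) : rdual := [the {linear U -> D^o} of \- f].
Definition rdual_add (f g : rdual) : rdual := [the {linear U -> D^o} of f \+ g].

Definition rdual_mul_fun (a : D^c) (f : rdual) : U -> D^o :=
  fun u => (f u : D) * (a : D).

Lemma rdual_mul_linear a f : linear (rdual_mul_fun a f).
Proof.
by move=> b u v; rewrite /rdual_mul_fun linearP mulrDl /= -mulrA.
Qed.

HB.instance Definition _ a f := GRing.isLinear.Build D U D^o *:%R
  (rdual_mul_fun a f) (rdual_mul_linear a f).

Definition rdual_mul (a : D^c) (f : rdual) : rdual :=
  [the {linear U -> D^o} of rdual_mul_fun a f].

Lemma rdual_addA : associative rdual_add.
Proof. by move=> f g h; apply: rdualP => u /=; rewrite addrA. Qed.
Lemma rdual_addC : commutative rdual_add.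
Proof. by move=> f g; apply: rdualP => u /=; rewrite addrC. Qed.
Lemma rdual_add0 : left_id rdual_zero rdual_add.
Proof. by move=> f; apply: rdualP => u /=; rewrite add0r. Qed.
Lemma rdual_addN : left_inverse rdual_zero rdual_opp rdual_add.
Proof. by move=> f; apply: rdualP => u /=; rewrite addNr. Qed.

HB.instance Definition _ := GRing.isZmodule.Build rdual
  rdual_addA rdual_addC rdual_add0 rdual_addN.

Lemma rdual_mulA a b f : rdual_mul a (rdual_mul b f) = rdual_mul (a * b) f.
Proof. by apply: rdualP => u; rewrite /= /rdual_mul_fun /= -mulrA. Qed.
Lemma rdual_mul1 : left_id 1 rdual_mul.
Proof. by move=> f; apply: rdualP => u; rewrite /= /rdual_mul_fun mulr1. Qed.
Lemma rdual_mulDr : right_distributive rdual_mul +%R.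
Proof. by move=> a f g; apply: rdualP => u; rewrite /= /rdual_mul_fun mulrDl. Qed.
Lemma rdual_mulDl f : {morph rdual_mul^~ f : a b / a + b}.
Proof. by move=> a b; apply: rdualP => u; rewrite /= /rdual_mul_fun mulrDr. Qed.

HB.instance Definition _ := GRing.Zmodule_isLmodule.Build D^c rdual
  rdual_mulA rdual_mul1 rdual_mulDr rdual_mulDl.
End RightDual.

Section RightDualMap.
Context (D : nzRingType) (U V : lmodType D) (g : {linear U -> V}).

Definition rdual_map (f : rdual V) : rdual U :=
  [the {linear U -> D^o} of (f : {linear V -> D^o}) \o g].

Lemma rdual_map_linear : linear rdual_map.
Proof. by move=> a f h; apply: rdualP. Qed.

HB.instance Definition _ := GRing.isLinear.Build D^c (rdual V) (rdual U) *:%R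
  rdual_map rdual_map_linear.
End RightDualMap.

Definition surjective (U V : Type) (f : U -> V) : Prop :=
  forall v, exists u, f u = v.

Definition projective (D : nzRingType) (P : lmodType D) : Prop :=
  forall (U V : lmodType D) (g : {linear U -> V}) (f : {linear P -> V}),
    surjective g -> exists h : {linear P -> U}, forall x, g (h x) = f x.

Record proj_resolution (D : nzRingType) (N : lmodType D) := ProjResolution {
  res_obj : nat -> lmodType D;
  res_diff : forall i, {linear res_obj i.+1 -> res_obj i};
  res_aug : {linear res_obj 0%N -> N};
  res_projective : forall i, projective (res_obj i);
  res_aug_surj : surjective res_aug;
  res_exact0 : forall x, res_aug x = 0 <-> exists y, x = res_diff 0 y;
  res_exactS : forall i x,
    res_diff i x = 0 <-> exists y, x = res_diff i.+1 y
}.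

Section FreeModule.
Context (D : nzRingType) (X : choiceType).
Import monalg.

Definition free_mod := {malg D[X]}.
HB.instance Definition _ := GRing.Lmodule.on free_mod.
Definition free_gen (x : X) : free_mod := << x >>.

Context (V : lmodType D) (u : X -> V).

Definition free_lift (g : free_mod) : V := \sum_(k <- msupp g) mcoeff k g *: u k.

Lemma free_liftEw (d : {fset X}) (g : free_mod) : (msupp g `<=` d)%fset ->
  free_lift g = \sum_(k <- d) mcoeff k g *: u k.
Proof.
move=> le; rewrite /free_lift [LHS](big_fset_incl _ le) //= => x xd.
by move=> /mcoeff_outdom ->; rewrite scale0r.
Qed.

Lemma free_lift_linear : linear free_lift.
Proof.
move=> a g h; pose E := (msupp (a *: g + h) `|` (msupp g `|` msupp h))%fset.
have Eagh : (msupp (a *: g + h) `<=` E)%fset by exact: fsubsetUl.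
have Eg : (msupp g `<=` E)%fset.
  by apply/fsubsetP => k kg; rewrite !in_fsetU kg orbT.
have Eh : (msupp h `<=` E)%fset.
  by apply/fsubsetP => k kh; rewrite !in_fsetU kh !orbT.
rewrite (free_liftEw Eagh) (free_liftEw Eg) (free_liftEw Eh).
rewrite scaler_sumr -big_split; apply: eq_bigr => k _ /=.
by rewrite mcoeffD mcoeffZ scalerDl scalerA.
Qed.

HB.instance Definition _ := GRing.isLinear.Build D free_mod V *:%R
  free_lift free_lift_linear.

Lemma free_liftU x : free_lift (free_gen x) = u x.
Proof.
rewrite (@free_liftEw [fset x]%fset) ?msuppU_le // big_seq_fset1.
by rewrite mcoeffUU scale1r.
Qed.

Lemma free_mod_ext (f g : {linear free_mod -> V}) :
  (forall x, f (free_gen x) = g (free_gen x)) -> f =1 g.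
Proof.
move=> efg h; rewrite [h]monalgE !raddf_sum; apply: eq_bigr => k _.
have -> : << mcoeff k h *g k >> = mcoeff k h *: free_gen k :> free_mod.
  by apply/malgP => j; rewrite mcoeffZ !mcoeffU mulrnAr mulr1.
by rewrite [LHS](linearZ_LR f) [RHS](linearZ_LR g) efg.
Qed.
End FreeModule.

Lemma free_mod_projective (D : nzRingType) (X : choiceType) :
  projective (free_mod D X).
Proof.
move=> U V g f gs; have /choice [u uP] : forall x, exists y,
  g y = f (free_gen D x) by move=> x; exact: gs.
exists [the {linear _ -> _} of free_lift u].
by apply: (free_mod_ext (f := [the {linear _ -> _} of g \o free_lift u])) => x
  /=; rewrite free_liftU uP.
Qed.

(* The canonical free resolution: each syzygy module is covered by the free  *)
(* module on its underlying set.                                             *)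
Section FreeResolution.
Context (D : nzRingType) (N : lmodType D).

Definition free_cover (V : lmodType D) : {linear free_mod D V -> V} :=
  [the {linear free_mod D V -> V} of free_lift (@idfun V)].

Lemma free_cover_surj V : surjective (free_cover V).
Proof. by move=> v; exists (free_gen D v); rewrite /= free_liftU. Qed.

Fixpoint syz (i : nat) : lmodType D :=
  if i is j.+1 then lker (free_cover (syz j)) else N.

Definition free_res_obj (i : nat) : lmodType D := free_mod D (syz i).

Definition free_res_diff (i : nat) :
    {linear free_res_obj i.+1 -> free_res_obj i} :=
  [the {linear _ -> _} of
     @lker_val D _ _ (free_cover (syz i)) \o free_cover (syz i.+1)].

Lemma free_res_exact i x :
  free_cover (syz i) x = 0 <-> exists y, x = free_res_diff i y.
Proof.
split=> [/eqP x0 | [y ->]]; last exact: lkerP.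
have [y yE] := @free_cover_surj (syz i.+1) (LKer x0).
by exists y; rewrite /= -/(syz i.+1) [free_lift _ _]yE.
Qed.

Lemma free_res_exactS i x :
  free_res_diff i x = 0 <-> exists y, x = free_res_diff i.+1 y.
Proof.
rewrite -free_res_exact /=; split=> [x0|->]; last by rewrite linear0.
by apply: val_inj; rewrite /= x0.
Qed.

Definition free_resolution : proj_resolution N :=
  @ProjResolution D N free_res_obj free_res_diff (free_cover N)
    (fun i => @free_mod_projective D (syz i)) (@free_cover_surj N)
    (@free_res_exact 0) free_res_exactS.
End FreeResolution.

(* Ext^n_D(N, D) as a right D-module: the n-th cohomology of Hom_D(P, D) for *)
(* a projective resolution P of N.  Up to isomorphism it does not depend on  *)
(* P; [Ext] fixes the canonical free resolution.                             *)
Section Ext.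
Context (D : nzRingType) (N : lmodType D).

Definition cocycle (P : proj_resolution N) (n : nat) : lmodType D^c :=
  lker [the {linear rdual (res_obj P n) -> rdual (res_obj P n.+1)} of
          rdual_map (res_diff P n)].

Definition coboundary (P : proj_resolution N) (n : nat) :
    cocycle P n -> Prop :=
  match n with
  | 0 => fun z => z = 0
  | m.+1 => fun z => exists f : rdual (res_obj P m),
                       lker_val z = rdual_map (res_diff P m) f
  end.

Definition Ext_of (P : proj_resolution N) (n : nat) : lmodType D^c :=
  lquot (@coboundary P n).

Definition Ext (n : nat) : lmodType D^c := Ext_of (free_resolution N) n.
End Ext.

Definition restrict_scalars (D E : nzRingType) (phi : {rmorphism D -> E})
  (M : lmodType E) : Type := M.

Section Restriction.
Context (D E : nzRingType) (phi : {rmorphism D -> E}) (M : lmodType E).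
Local Notation resM := (restrict_scalars phi M).

HB.instance Definition _ := GRing.Zmodule.on resM.

Definition restrict_scale (a : D) (m : resM) : resM := phi a *: (m : M).

Lemma restrict_scaleA a b m :
  restrict_scale a (restrict_scale b m) = restrict_scale (a * b) m.
Proof. by rewrite /restrict_scale scalerA rmorphM. Qed.
Lemma restrict_scale1 : left_id 1 restrict_scale.
Proof. by move=> m; rewrite /restrict_scale rmorph1 scale1r. Qed.
Lemma restrict_scaleDr : right_distributive restrict_scale +%R.
Proof. by move=> a m p; rewrite /restrict_scale scalerDr. Qed.
Lemma restrict_scaleDl m : {morph restrict_scale^~ m : a b / a + b}.
Proof. by move=> a b; rewrite /restrict_scale rmorphD scalerDl. Qed.

HB.instance Definition _ := GRing.Zmodule_isLmodule.Build D resM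
  restrict_scaleA restrict_scale1 restrict_scaleDr restrict_scaleDl.
End Restriction.

(* The Weyl algebra K<x_1..x_n, d_1..d_n>, presented as the K-algebra with   *)
(* these generators and the Weyl relations: terms in the ring operations     *)
(* modulo the congruence generated by the K-algebra axioms and the relations *)
(* [x_i, x_j] = [d_i, d_j] = 0 and [d_i, x_j] = delta_ij.                     *)
Section Weyl.
Context (K : fieldType) (n : nat).

Inductive wterm :=
| WC of K | WX of 'I_n | WD of 'I_n
| WOpp of wterm | WAdd of wterm & wterm | WMul of wterm & wterm.

Inductive weq : wterm -> wterm -> Prop :=
| weq_refl t : weq t t
| weq_sym t u : weq t u -> weq u t
| weq_trans t u v : weq t u -> weq u v -> weq t v
| weq_opp t t' : weq t t' -> weq (WOpp t) (WOpp t')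
| weq_add t t' u u' : weq t t' -> weq u u' -> weq (WAdd t u) (WAdd t' u')
| weq_mul t t' u u' : weq t t' -> weq u u' -> weq (WMul t u) (WMul t' u')
| weq_addA t u v : weq (WAdd t (WAdd u v)) (WAdd (WAdd t u) v)
| weq_addC t u : weq (WAdd t u) (WAdd u t)
| weq_add0 t : weq (WAdd (WC 0) t) t
| weq_addN t : weq (WAdd (WOpp t) t) (WC 0)
| weq_mulA t u v : weq (WMul t (WMul u v)) (WMul (WMul t u) v)
| weq_mul1l t : weq (WMul (WC 1) t) t
| weq_mul1r t : weq (WMul t (WC 1)) t
| weq_mulDl t u v : weq (WMul (WAdd t u) v) (WAdd (WMul t v) (WMul u v))
| weq_mulDr t u v : weq (WMul t (WAdd u v)) (WAdd (WMul t u) (WMul t v))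
| weq_CD a b : weq (WC (a + b)) (WAdd (WC a) (WC b))
| weq_CM a b : weq (WC (a * b)) (WMul (WC a) (WC b))
| weq_Ccomm a t : weq (WMul (WC a) t) (WMul t (WC a))
| weq_XX i j : weq (WMul (WX i) (WX j)) (WMul (WX j) (WX i))
| weq_DD i j : weq (WMul (WD i) (WD j)) (WMul (WD j) (WD i))
| weq_DX i j :
    weq (WMul (WD i) (WX j)) (WAdd (WMul (WX j) (WD i)) (WC (i == j)%:R)).

HB.instance Definition _ := gen_eqMixin wterm.
HB.instance Definition _ := gen_choiceMixin wterm.

Definition weqb (t u : wterm) : bool := `[< weq t u >].

Lemma weqb_equiv : equiv_class_of weqb.
Proof.
split=> [t|t u|u t v]; first exact/asboolP/weq_refl.
- by apply/asboolP/asboolP; apply: weq_sym.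
- by move=> /asboolP tu /asboolP uv; apply/asboolP/(weq_trans tu uv).
Qed.

Canonical weqb_equivRel := EquivRelPack weqb_equiv.
Canonical weqb_encModRel := defaultEncModRel weqb.

Definition weyl := {eq_quot weqb}.
HB.instance Definition _ : EqQuotient wterm weqb weyl := EqQuotient.on weyl.
HB.instance Definition weyl_choice := Choice.on weyl.

Lemma weylP t u : weq t u -> \pi_weyl t = \pi_weyl u.
Proof. by move=> tu; apply/eqmodP/asboolP. Qed.

Lemma weyl_eq t u : \pi_weyl t = \pi_weyl u -> weq t u.
Proof. by move=> /eqmodP/asboolP. Qed.

Lemma weq_repr t : weq (repr (\pi_weyl t)) t.
Proof. by apply: weyl_eq; rewrite reprK. Qed.

Definition weyl_opp := lift_op1 weyl WOpp.
Definition weyl_add := lift_op2 weyl WAdd.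
Definition weyl_mul := lift_op2 weyl WMul.

Lemma pi_weyl_opp : {morph \pi_weyl : t / WOpp t >-> weyl_opp t}.
Proof.
by move=> t; unlock weyl_opp; apply/weylP/weq_opp/weq_sym/weq_repr.
Qed.
Lemma pi_weyl_add : {morph \pi_weyl : t u / WAdd t u >-> weyl_add t u}.
Proof.
by move=> t u; unlock weyl_add; apply/weylP/weq_add; apply/weq_sym/weq_repr.
Qed.
Lemma pi_weyl_mul : {morph \pi_weyl : t u / WMul t u >-> weyl_mul t u}.
Proof.
by move=> t u; unlock weyl_mul; apply/weylP/weq_mul; apply/weq_sym/weq_repr.
Qed.

Let wE := (pi_weyl_opp, pi_weyl_add, pi_weyl_mul).
Definition weyl_const (a : K) : weyl := \pi_weyl (WC a).
Definition weyl_x (i : 'I_n) : weyl := \pi_weyl (WX i).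
Definition weyl_d (i : 'I_n) : weyl := \pi_weyl (WD i).

Lemma weyl_addA : associative weyl_add.
Proof.
move=> x y z; rewrite -[x]reprK -[y]reprK -[z]reprK -!wE.
exact/weylP/weq_addA.
Qed.
Lemma weyl_addC : commutative weyl_add.
Proof.
by move=> x y; rewrite -[x]reprK -[y]reprK -!wE; exact/weylP/weq_addC.
Qed.
Lemma weyl_add0 : left_id (weyl_const 0) weyl_add.
Proof. by move=> x; rewrite -[x]reprK -!wE; exact/weylP/weq_add0. Qed.
Lemma weyl_addN : left_inverse (weyl_const 0) weyl_opp weyl_add.
Proof. by move=> x; rewrite -[x]reprK -!wE; exact/weylP/weq_addN. Qed.

HB.instance Definition _ := GRing.isZmodule.Build weyl
  weyl_addA weyl_addC weyl_add0 weyl_addN.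

Lemma weyl_mulA : associative weyl_mul.
Proof.
move=> x y z; rewrite -[x]reprK -[y]reprK -[z]reprK -!wE.
exact/weylP/weq_mulA.
Qed.
Lemma weyl_mul1l : left_id (weyl_const 1) weyl_mul.
Proof. by move=> x; rewrite -[x]reprK -!wE; exact/weylP/weq_mul1l. Qed.
Lemma weyl_mul1r : right_id (weyl_const 1) weyl_mul.
Proof. by move=> x; rewrite -[x]reprK -!wE; exact/weylP/weq_mul1r. Qed.
Lemma weyl_mulDl : left_distributive weyl_mul weyl_add.
Proof.
move=> x y z; rewrite -[x]reprK -[y]reprK -[z]reprK -!wE.
exact/weylP/weq_mulDl.
Qed.
Lemma weyl_mulDr : right_distributive weyl_mul weyl_add.
Proof.
move=> x y z; rewrite -[x]reprK -[y]reprK -[z]reprK -!wE.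
exact/weylP/weq_mulDr.
Qed.

(* Nontriviality, through the action on the polynomial ring. *)
Fixpoint wact (t : wterm) (p : {mpoly K[n]}) : {mpoly K[n]} :=
  match t with
  | WC a => a *: p
  | WX i => 'X_i * p
  | WD i => p^`M(i)
  | WOpp t => - wact t p
  | WAdd t u => wact t p + wact u p
  | WMul t u => wact t (wact u p)
  end.

Lemma wact_linear t a p q : wact t (a *: p + q) = a *: wact t p + wact t q.
Proof.
elim: t p q => [b|i|i|t IH|t IHt u IHu|t IHt u IHu] p q //=.
- by rewrite scalerDr !scalerA mulrC.
- by rewrite mulrDr scalerAr.
- by rewrite linearP.
- by rewrite IH opprD scalerN.
- by rewrite IHt IHu scalerDr addrACA.
- by rewrite IHu IHt.
Qed.

Lemma wact_weq t u : weq t u -> wact t =1 wact u.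
Proof.
elim=> {t u} //=.
- by move=> t u _ IH p; rewrite IH.
- by move=> t u v _ IH _ IH' p; rewrite IH.
- by move=> t t' _ IH p; rewrite IH.
- by move=> t t' u u' _ IH _ IH' p; rewrite IH IH'.
- by move=> t t' u u' _ IH _ IH' p; rewrite IH' IH.
- by move=> t u v p; rewrite addrA.
- by move=> t u p; rewrite addrC.
- by move=> t p; rewrite scale0r add0r.
- by move=> t p; rewrite addNr scale0r.
- by move=> t p; rewrite scale1r.
- by move=> t p; rewrite scale1r.
- by move=> t u v p; have := wact_linear t 1 (wact u p) (wact v p);
     rewrite !scale1r.
- by move=> a b p; rewrite scalerDl.
- by move=> a b p; rewrite scalerA.
- move=> a t p; have := wact_linear t a p 0.
  have -> : wact t 0 = 0.
    by have := wact_linear t (-1) 0 0; rewrite scaler0 addr0 scaleN1r addNr.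
  by rewrite !addr0 => ->.
- by move=> i j p; rewrite mulrCA.
- by move=> i j p; rewrite mderiv_comm.
- move=> i j p; rewrite mderivM mderivX mnmE addrC; congr (_ + _).
  case: (eqVneq i j) => [->|]; last by rewrite !scale0r mul0r.
  have -> : (U_(j) - U_(j) = 0 :> 'X_{1..n})%MM.
    by apply/mnmP => k; rewrite mnmBE subnn mnm0E.
  by rewrite !scale1r mpolyX0 mul1r.
Qed.

Lemma weyl_oner_neq0 : weyl_const 1 != 0.
Proof.
apply/eqP => /weyl_eq/wact_weq/(_ 1) /=.
by rewrite scale1r scale0r => /eqP; rewrite oner_eq0.
Qed.

HB.instance Definition _ := GRing.Zmodule_isNzRing.Build weyl
  weyl_mulA weyl_mul1l weyl_mul1r weyl_mulDl weyl_mulDr weyl_oner_neq0.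

Lemma weylN t : \pi_weyl (WOpp t) = - \pi_weyl t.
Proof. exact: pi_weyl_opp. Qed.
Lemma weylD t u : \pi_weyl (WAdd t u) = \pi_weyl t + \pi_weyl u.
Proof. exact: pi_weyl_add. Qed.
Lemma weylM t u : \pi_weyl (WMul t u) = \pi_weyl t * \pi_weyl u.
Proof. exact: pi_weyl_mul. Qed.

Lemma weyl_const_zmod : zmod_morphism weyl_const.
Proof.
have cD a b : weyl_const (a + b) = weyl_const a + weyl_const b.
  by rewrite -weylD; exact/weylP/weq_CD.
by move=> a b; apply/(addIr (weyl_const b)); rewrite -cD !subrK.
Qed.
Lemma weyl_const_monoid : monoid_morphism weyl_const.
Proof. by split=> // a b; rewrite -weylM; exact/weylP/weq_CM. Qed.

HB.instance Definition _ := GRing.isZmodMorphism.Build K weyl weyl_const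
  weyl_const_zmod.
HB.instance Definition _ := GRing.isMonoidMorphism.Build K weyl weyl_const
  weyl_const_monoid.

Lemma weyl_constC a (x : weyl) : weyl_const a * x = x * weyl_const a.
Proof. by rewrite -[x]reprK -!weylM; exact/weylP/weq_Ccomm. Qed.
Lemma weyl_xxC i j : weyl_x i * weyl_x j = weyl_x j * weyl_x i.
Proof. by rewrite -!weylM; exact/weylP/weq_XX. Qed.
Lemma weyl_ddC i j : weyl_d i * weyl_d j = weyl_d j * weyl_d i.
Proof. by rewrite -!weylM; exact/weylP/weq_DD. Qed.
Lemma weyl_dx i j :
  weyl_d i * weyl_x j = weyl_x j * weyl_d i + (i == j)%:R.
Proof.
rewrite -(rmorph_nat weyl_const) -!weylM -weylD.
exact/weylP/weq_DX.
Qed.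

(* The standard transposition x^u d^v |-> (-d)^v x^u, an anti-automorphism.  *)
Fixpoint wtransp (t : wterm) : wterm :=
  match t with
  | WC a => WC a
  | WX i => WX i
  | WD i => WOpp (WD i)
  | WOpp t => WOpp (wtransp t)
  | WAdd t u => WAdd (wtransp t) (wtransp u)
  | WMul t u => WMul (wtransp u) (wtransp t)
  end.

Lemma wtransp_weq t u : weq t u -> \pi_weyl (wtransp t) = \pi_weyl (wtransp u).
Proof.
elim=> {t u} //=.
- by move=> t u v _ -> _ ->.
- by move=> t t' _ IH; rewrite !weylN IH.
- by move=> t t' u u' _ IH _ IH'; rewrite !weylD IH IH'.
- by move=> t t' u u' _ IH _ IH'; rewrite !weylM IH IH'.
- by move=> t u v; rewrite !weylD addrA.
- by move=> t u; rewrite !weylD addrC.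
- by move=> t; rewrite weylD add0r.
- by move=> t; rewrite weylD weylN addNr.
- by move=> t u v; rewrite !weylM mulrA.
- by move=> t; rewrite weylM mulr1.
- by move=> t; rewrite weylM mul1r.
- by move=> t u v; rewrite !(weylM, weylD) mulrDr.
- by move=> t u v; rewrite !(weylM, weylD) mulrDl.
- by move=> a b; rewrite weylD -!/(weyl_const _) rmorphD.
- by move=> a b; rewrite weylM -!/(weyl_const _) rmorphM weyl_constC.
- by move=> a t; rewrite !weylM -!/(weyl_const _) weyl_constC.
- by move=> i j; rewrite !weylM weyl_xxC.
- by move=> i j; rewrite !weylM !weylN !mulNr !mulrN weyl_ddC.
- move=> i j; rewrite !(weylM, weylN, weylD) -/(weyl_const _) rmorph_nat.
  by rewrite -/(weyl_d i) -/(weyl_x j) mulNr weyl_dx mulrN opprD subrK.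
Qed.

Definition transp (x : weyl) : weyl^c := \pi_weyl (wtransp (repr x)).

Lemma transp_pi t : transp (\pi_weyl t) = \pi_weyl (wtransp t).
Proof. exact/wtransp_weq/weq_repr. Qed.

Lemma transp_zmod : zmod_morphism transp.
Proof.
move=> x y; rewrite -[x]reprK -[y]reprK -weylN -weylD !transp_pi /=.
by rewrite weylD weylN.
Qed.
Lemma transp_monoid : monoid_morphism transp.
Proof.
split=> [|x y]; first by rewrite -[1]/(\pi_weyl (WC 1)) transp_pi.
by rewrite -[x]reprK -[y]reprK -weylM !transp_pi /= weylM.
Qed.

HB.instance Definition _ := GRing.isZmodMorphism.Build weyl weyl^c transp
  transp_zmod.
HB.instance Definition _ := GRing.isMonoidMorphism.Build weyl weyl^c transp
  transp_monoid.

Lemma transp_const a : transp (weyl_const a) = weyl_const a.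
Proof. exact: transp_pi. Qed.
Lemma transp_x i : transp (weyl_x i) = weyl_x i.
Proof. exact: transp_pi. Qed.
Lemma transp_d i : transp (weyl_d i) = - weyl_d i.
Proof. by rewrite transp_pi weylN. Qed.

(* tau (Ext^n_D(N, D)): an element a of D acts on the left as tau(a) acts on  *)
(* the right.                                                                 *)
Definition holonomic_dual (N : lmodType weyl) : lmodType weyl :=
  restrict_scalars [the {rmorphism weyl -> weyl^c} of transp] (Ext N n).
End Weyl.

Section GKZ.
Context (K : fieldType) (d n : nat) (A : 'M[int]_(d, n)).

Record gkz_matrix : Prop := GkzMatrix {
  gkz_distinct : injective (fun j => col j A);
  gkz_full : forall v : 'cV[int]_d,
    exists k : 'I_n -> int, v = \sum_j col j A *~ k j;
  gkz_pointed : forall v : 'cV[int]_d,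
    (exists k : 'I_n -> nat, v = \sum_j col j A *+ k j) ->
    (exists k : 'I_n -> nat, - v = \sum_j col j A *+ k j) -> v = 0
}.

(* The Laurent polynomials K[t_1^+-1 .. t_d^+-1] are viewed inside K(t).      *)
Definition toric_map (p : {mpoly K[n]}) : {fraction {mpoly K[d]}} :=
  mmap (fun c => tofrac c%:MP)
       (fun j => \prod_(i < d) tofrac 'X_i ^ A i j) p.

Definition toric_ideal (p : {mpoly K[n]}) : Prop := toric_map p = 0.

Definition diff_op (p : {mpoly K[n]}) : weyl K n :=
  mmap (@weyl_const K n) (@weyl_d K n) p.

Definition euler (i : 'I_d) : weyl K n :=
  \sum_(j < n) (A i j)%:~R * weyl_x K j * weyl_d K j.

Variant gkz_relation (beta : 'cV[K]_d) : (weyl K n)^o -> Prop :=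
| gkz_toric p : toric_ideal p -> gkz_relation beta (diff_op p)
| gkz_euler i : gkz_relation beta (euler i - weyl_const n (beta i 0)).

Definition gkz (beta : 'cV[K]_d) : lmodType (weyl K n) :=
  lquot (gkz_relation beta).
End GKZ.

(* Main.v *)
From HB Require Import structures.
Require Import Defs.
From mathcomp Require Import all_boot all_algebra reals complex.
From mathcomp Require Import generic_quotient ring_quotient boolp fraction.
From mathcomp Require Import mpoly zify.

Set Implicit Arguments.
Unset Strict Implicit.
Unset Printing Implicit Defensive.

Import GRing.Theory.
Local Open Scope ring_scope.
Local Open Scope quotient_scope.

(** The obstruction is the dimension of the space of maps to the polynomial
    module [K[x]]: it is at most 1 for a classical GKZ-system and at least 2
    for the dual [M].

    A map [H_B(beta') -> K[x]] is a polynomial solution of [H_B(beta')].  The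
    Euler operators force all its exponents [u] to have the same degree [B u],
    and the toric binomials [d^u - d^u'] force the numbers [u! c_u] attached to
    the coefficients [c_u] to be equal along that fibre.  So any two polynomial
    solutions are proportional ([gkz_solution_unique]).

    For the dual of [N = H_A(1,2)], duality turns maps [M -> K[x]] into flat
    elements of [N], those killed by all [d_i].  The exponents [m_i] of
    [d_2^2, d_1 d_3, d_2 d_4, d_3^2] have degrees [a_i + (1,2)], while [(1,2)]
    is a gap of the semigroup generated by the columns [a_i] of [A] (this gap
    is also why the rank of [H_A(beta)] jumps at [(1,2)]).  Each row [r] of [A]
    then gives the flat element [v_r], the sum of [a_rj x_j d^(m_j)] over [j]
    ([euler_class_flat]).

    The duality is used in the following explicit form.  A flat element [v]
    lifts to a chain map from the Koszul resolution of [K[x]] to the free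
    resolution [F] of [N] ([koszul_lift]); evaluating a cocycle [F_n -> D] on
    the top element of that lift, modulo the right ideal generated by the
    [d_i], gives the map [M -> K[x]] attached to [v] ([flat_pairing]).  To see
    that [v_1] and [v_2] give independent maps, cocycles are needed.  These
    come from the Laurent solutions [x_2^2/x_1] and [x_3^2/x_4], seen as maps
    from [N] to [K[x, 1/x_1]] and [K[x, 1/x_4]].  The module [K[x, 1/x_e]] is
    [D/D(d_e x_e, d_j : j != e)], whose generators commute and form a regular
    sequence for right multiplication, so the map climbs along [F] one
    generator at a time and ends as a cocycle on [F_n] ([koszul_cocycle]).  If
    [v] is sent to [c] in [K[x, 1/x_e]], then the cocycle takes the value
    [c] on the suitably ordered top element of the lift of [v], up to the right
    ideal.  Since [v_1, v_2] go to [2, 0] for [x_2^2/x_1] and to [2, 8] for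
    [x_3^2/x_4], the two maps [M -> K[x]] are independent ([dual_not_gkz]). *)

(** * Koszul differentials *)

Section Koszul.
Context (D : nzRingType) (I : Type).
Implicit Types (w : I -> D) (l : seq I).

(** The Koszul differential of a family of operators [w], on cochains indexed
    by arbitrary sequences of indices instead of increasing ones: the identities
    then hold on every sequence, and cochains can be chosen on all of them
    without antisymmetry. *)
Fixpoint kdiff (V : lmodType D) w (a : seq I -> V) l : V :=
  if l is m :: l' then w m *: a l' - kdiff w (fun k => a (m :: k)) l' else 0.

Lemma eq_kdiff (V : lmodType D) w (a b : seq I -> V) :
  a =1 b -> kdiff w a =1 kdiff w b.
Proof.
move=> ab l; elim: l a b ab => //= m l IH a b ab.
by rewrite ab (IH _ (fun k => b (m :: k))) // => k; rewrite ab.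
Qed.

Lemma kdiffD (V : lmodType D) w (a b : seq I -> V) l :
  kdiff w (fun k => a k + b k) l = kdiff w a l + kdiff w b l.
Proof.
elim: l a b => [|m l IH] a b /=; first by rewrite addr0.
by rewrite (IH (fun k => a (m :: k))) scalerDr opprD addrACA.
Qed.

Lemma kdiff_const (V : lmodType D) w (v : V) l :
  (forall i, w i *: v = 0) -> kdiff w (fun=> v) l = 0.
Proof. by move=> wv; elim: l => //= m l ->; rewrite wv subr0. Qed.

Lemma kdiff_linear (U V : lmodType D) w (f : {linear U -> V}) a l :
  f (kdiff w a l) = kdiff w (f \o a) l.
Proof.
elim: l a => [|m l IH] a /=; first exact: linear0.
by rewrite linearB linearZ /= IH.
Qed.

Lemma kdiffZ (V : lmodType D) w c (a : seq I -> V) l :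
  (forall i, w i * c = c * w i) ->
  kdiff w (fun k => c *: a k) l = c *: kdiff w a l.
Proof.
move=> wc; elim: l a => [|m l IH] a /=; first by rewrite scaler0.
by rewrite (IH (fun k => a (m :: k))) !scalerA wc scalerBr scalerA.
Qed.

Lemma kdiffN (V : lmodType D) w (a : seq I -> V) l :
  kdiff w (fun k => - a k) l = - kdiff w a l.
Proof.
rewrite -scaleN1r -kdiffZ => [|i]; last by rewrite mulrN1 mulN1r.
by apply: eq_kdiff => k; rewrite scaleN1r.
Qed.

Lemma kdiffB (V : lmodType D) w (a b : seq I -> V) l :
  kdiff w (fun k => a k - b k) l = kdiff w a l - kdiff w b l.
Proof. by rewrite kdiffD kdiffN. Qed.

Lemma kdiffM w (a : seq I -> D^o) (t : D) l :
  kdiff w (fun k => a k * t : D^o) l = (kdiff w a l : D) * t.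
Proof.
elim: l a => [|m l IH] a /=; first by rewrite mul0r.
by rewrite (IH (fun k => a (m :: k))) mulrBl -mulrA.
Qed.

Lemma kdiff_comm (V : lmodType D) w w' (a : seq I -> V) l :
  (forall i j, w i * w' j = w' j * w i) ->
  kdiff w (kdiff w' a) l = - kdiff w' (kdiff w a) l.
Proof.
move=> ww'; elim: l a => [|m l IH] a /=; first by rewrite oppr0.
rewrite !kdiffB !kdiffZ //.
rewrite (IH (fun k => a (m :: k))) opprK [RHS]opprB opprD addrA.
exact: addrAC.
Qed.

Lemma kdiff_kdiff (V : lmodType D) w (a : seq I -> V) l :
  (forall i j, w i * w j = w j * w i) -> kdiff w (kdiff w a) l = 0.
Proof.
move=> ww; elim: l a => //= m l IH a.
by rewrite kdiffB kdiffZ // (IH (fun k => a (m :: k))) subr0 subrr.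
Qed.

End Koszul.

Section Indicator.
Context (D : nzRingType) (I : eqType).

(** With [ind i] as weights the Koszul differential is the exterior product
    with the i-th coordinate: it extracts the coefficient of [w i] in the
    differential with weights [w]. *)
Definition ind (i m : I) : D := (m == i)%:R.

Lemma ind_central i m (c : D) : ind i m * c = c * ind i m.
Proof. by rewrite /ind mulr_natl mulr_natr. Qed.

Lemma kdiff_ind_notin (V : lmodType D) i (a : seq I -> V) l :
  i \notin l -> kdiff (ind i) a l = 0.
Proof.
elim: l a => //= m l IH a; rewrite in_cons negb_or eq_sym => /andP[mi il].
by rewrite IH // /ind (negbTE mi) scale0r subr0.
Qed.

Lemma kdiff_ind_cons (V : lmodType D) i (a : seq I -> V) l :
  i \notin l -> kdiff (ind i) a (i :: l) = a l.
Proof. by move=> il /=; rewrite kdiff_ind_notin // /ind eqxx scale1r subr0. Qed.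

End Indicator.

Lemma kdiff_sum_ind (D : nzRingType) (I : finType) (V : lmodType D) (w : I -> D)
    (a : seq I -> V) l :
  kdiff w a l = \sum_i kdiff (ind D i) (fun k => w i *: a k) l.
Proof.
elim: l a => [|m l IH] a /=; first by rewrite big1.
rewrite big_split /= sumrN -IH (bigD1 m) //= /ind eqxx scale1r big1 ?addr0 //.
by move=> i; rewrite eq_sym => /negbTE->; rewrite scale0r.
Qed.

(** * Left ideals and regular sequences *)

Section LeftIdeal.
Context (D : nzRingType).
Implicit Types (s : seq D) (P Q : D).

(** The left ideal generated by [s], described so that the generators can be
    split off one at a time, in order. *)
Fixpoint lideal s P : Prop :=
  if s is t :: s' then exists Q, lideal s' (P - Q * t) else P = 0.

Lemma lidealP s a P Q : lideal s P -> lideal s Q -> lideal s (a * P + Q).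
Proof.
elim: s P Q => [|t s IH] P Q /=; first by move=> -> ->; rewrite mulr0 addr0.
move=> [P' HP] [Q' HQ]; exists (a * P' + Q').
have := IH _ _ HP HQ; congr (lideal s _).
by rewrite mulrBr mulrDl -mulrA addrACA opprD.
Qed.

Lemma lideal0 s : lideal s 0.
Proof. by elim: s => //= t s IH; exists 0; rewrite mul0r subr0. Qed.

Lemma lidealD s P Q : lideal s P -> lideal s Q -> lideal s (P + Q).
Proof. by move=> HP /(lidealP 1 HP); rewrite mul1r. Qed.

Lemma lidealM s a P : lideal s P -> lideal s (a * P).
Proof. by move=> /(lidealP a)/(_ (lideal0 s)); rewrite addr0. Qed.

Lemma lidealN s P : lideal s P -> lideal s (- P).
Proof. by move=> /(lidealM (-1)); rewrite mulN1r. Qed.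

Lemma lidealB s P Q : lideal s P -> lideal s Q -> lideal s (P - Q).
Proof. by move=> HP /lidealN; apply: lidealD. Qed.

Lemma lideal_cons t s P : lideal s P -> lideal (t :: s) P.
Proof. by move=> HP; exists 0; rewrite mul0r subr0. Qed.

Lemma lideal_gen s t P : t \in s -> lideal s (P * t).
Proof.
elim: s => //= u s IH; rewrite in_cons => /predU1P[->|/IH ts].
  by exists P; rewrite subrr; exact: lideal0.
exact: lideal_cons.
Qed.

Lemma lideal_mulr s y P :
  (forall t, t \in s -> t * y = y * t) -> lideal s P -> lideal s (P * y).
Proof.
elim: s P => [|t s IH] P sy /=; first by move=> ->; rewrite mul0r.
move=> [Q HQ]; exists (Q * y).
rewrite -mulrA -(sy t) ?mem_head // mulrA -mulrBl.
by apply: IH => // u us; apply: sy; rewrite in_cons us orbT.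
Qed.

Lemma lideal_kdiff (I : Type) s (w : I -> D) (a : seq I -> D^o) l :
  (forall k, lideal s (a k)) -> lideal s (kdiff w a l : D).
Proof.
elim: l a => [|m l IH] a sa /=; first exact: lideal0.
by apply: lidealB; [exact: lidealM | exact: IH].
Qed.

Lemma lideal_sum (I : Type) s (r : seq I) (p : pred I) (F : I -> D) :
  (forall i, p i -> lideal s (F i)) -> lideal s (\sum_(i <- r | p i) F i).
Proof.
by move=> sF; elim/big_ind: _ => //; [exact: lideal0 | exact: lidealD].
Qed.

Definition ad (y P : D) : D := P * y - y * P.

(** Commuting [P * t] with [y] gives [ad y P * t + P]; iterating, the ideal
    contains [ad^(j+1) P * t + (j+1) ad^j P] for all [j].  As [ad y] is
    nilpotent on [P], descending induction on [j] puts every [ad^j P] in the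
    ideal. *)
Lemma lideal_regular s t y P :
    t * y = y * t + 1 -> (forall u, u \in s -> u * t = t * u) ->
    (forall u, u \in s -> u * y = y * u) ->
    (exists N, iter N (ad y) P = 0) ->
    (forall j, exists c : D, c * j.+1%:R = 1) ->
  lideal s (P * t) -> lideal s P.
Proof.
move=> ty st sy [N adN] inv sPt.
have ad_s Q : lideal s Q -> lideal s (ad y Q).
  by move=> sQ; apply: lidealB; [exact: lideal_mulr | exact: lidealM].
have adM Q : ad y (Q * t) = ad y Q * t + Q.
  by rewrite /ad -mulrA ty mulrDr mulr1 mulrBl -!mulrA addrAC.
have H j : lideal s (iter j.+1 (ad y) P * t + iter j (ad y) P *+ j.+1).
  elim: j => [|j IH]; first by rewrite /= -adM; exact: ad_s.
  have := ad_s _ IH.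
  set A := iter j.+1 _ _; set B := iter j _ _.
  rewrite /ad mulrDl mulrDr opprD addrACA -/(ad y (A * t)) adM.
  rewrite mulrnAl mulrnAr -mulrnBl -/(ad y B) -/A.
  by rewrite -addrA -mulrS.
suff down j : (j <= N)%N -> lideal s (iter (N - j) (ad y) P).
  by have := down N (leqnn N); rewrite subnn.
elim: j => [|j IH] jN; first by rewrite subn0 adN; exact: lideal0.
have E : (N - j = (N - j.+1).+1)%N by rewrite subnSK.
have {IH} := IH (ltnW jN); rewrite E => IH.
have [c cE] := inv (N - j.+1)%N.
have /(lidealM c) := lidealB (H (N - j.+1)%N) (lideal_mulr st IH).
by rewrite addrAC subrr add0r -mulr_natl mulrA cE mul1r.
Qed.
End LeftIdeal.

Arguments lideal : simpl never.

(** * Koszul lifts of flat elements *)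

Section KoszulLift.
Context (D : nzRingType) (N : lmodType D) (I : Type) (w : I -> D) (v : N).

Definition some_preim (U V : lmodType D) (f : U -> V) (y : V) : U :=
  if pselect (exists x, f x = y) is left ex then sval (cid ex) else 0.

Lemma some_preimK (U V : lmodType D) (f : U -> V) y :
  (exists x, f x = y) -> f (some_preim f y) = y.
Proof.
by move=> ex; rewrite /some_preim; case: pselect => // ex'; case: (cid ex').
Qed.

(** The chain map from a Koszul complex to the free resolution that lifts the
    map sending the generator to [v]. *)
Fixpoint koszul_lift p : seq I -> free_res_obj N p :=
  match p with
  | 0 => fun=> free_gen D v
  | q.+1 => fun l =>
      some_preim (free_res_diff N q) (kdiff w (koszul_lift q) l)
  end.

(** The preimages chosen in [koszul_lift] exist because the Koszul
    differential squares to zero and the resolution is exact. *)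
Lemma koszul_liftP p l :
    (forall i j, w i * w j = w j * w i) -> (forall i, w i *: v = 0) ->
  free_res_diff N p (koszul_lift p.+1 l) = kdiff w (koszul_lift p) l.
Proof.
move=> ww wv; elim: p l => [|p IH] l; rewrite [koszul_lift _]/=;
  apply: some_preimK.
  suff /(free_res_exact (N := N) (i := 0))[y ->] :
    free_cover N (kdiff w (koszul_lift 0) l) = 0 by exists y.
  rewrite kdiff_linear -[RHS](kdiff_const (w := w) l wv).
  by apply: eq_kdiff => k /=; rewrite free_liftU.
suff /free_res_exactS[y ->] :
  free_res_diff N p (kdiff w (koszul_lift p.+1) l) = 0 by exists y.
rewrite kdiff_linear -[RHS](kdiff_kdiff (koszul_lift p) l ww).
by apply: eq_kdiff => k; rewrite /comp IH.
Qed.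

End KoszulLift.

(** * Climbing along the free resolution *)

Section Cochain.
Context (D : nzRingType) (N : lmodType D).

Lemma free_mod_lideal (X : choiceType) (s : seq D)
    (H : {linear free_mod D X -> D^o}) :
  (forall x, lideal s (H (free_gen D x) : D)) -> forall f, lideal s (H f : D).
Proof.
move=> sH f.
have -> : H f = free_lift (fun x => H (free_gen D x)) f.
  apply: (free_mod_ext
    (g := [the {linear _ -> D^o} of free_lift (fun x => H (free_gen D x))])).
  by move=> x /=; rewrite free_liftU.
rewrite /free_lift; elim/big_ind: _ => [|P Q|x _].
- exact: lideal0.
- exact: lidealD.
- exact: lidealM.
Qed.

(** One dimension shift: the extension of [D/(s, t)] by [D/s] defined by right
    multiplication by [t] turns a map from the p-th syzygies to [D/(s, t)] into
    a map from the next ones to [D/s].  Both maps are represented by their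
    lifts to [D] on the free modules. *)
Lemma cochain_step p (t : D) (s : seq D)
    (H : {linear free_res_obj N p -> D^o}) :
    (forall P : D, lideal s (P * t) -> lideal s P) ->
    (forall f, lideal (t :: s) (H (free_res_diff N p f) : D)) ->
  exists H' : {linear free_res_obj N p.+1 -> D^o},
    (forall f, lideal s (H' (free_res_diff N p.+1 f) : D)) /\
    (forall f, lideal s ((H (free_res_diff N p f) : D) - (H' f : D) * t)).
Proof.
move=> reg HJ.
have /choice[h hP] x : exists Q : D, lideal s
    ((H (free_res_diff N p (free_gen D x)) : D) - Q * t) by exact: HJ.
pose H' := [the {linear free_res_obj N p.+1 -> D^o} of
  free_lift (h : _ -> D^o)].
have HH' f : lideal s ((H (free_res_diff N p f) : D) - (H' f : D) * t).
  pose g f := (H (free_res_diff N p f) : D) - (H' f : D) * t : D^o.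
  have glin : linear g.
    move=> a x y; rewrite /g !linearP.
    set hx := H _; set hy := H _; set hx' := H' x; set hy' := H' y.
    rewrite -[a *: hx]/(a * (hx : D)) -[a *: hx']/(a * (hx' : D)).
    by rewrite mulrDl opprD addrACA -mulrA -mulrBr.
  pose gL : GRing.isLinear _ _ _ _ g := GRing.isLinear.Build _ _ _ _ g glin.
  pose G : {linear free_mod D _ -> D^o} := HB.pack g gL.
  apply: (free_mod_lideal (H := G)) => x.
  by rewrite -[G _]/(g _) /g -[H' _]/(free_lift (h : _ -> D^o) _) free_liftU.
exists H'; split=> // f; apply: reg.
have := lidealN (HH' (free_res_diff N p.+1 f)).
have -> : free_res_diff N p (free_res_diff N p.+1 f) = 0.
  by apply/free_res_exactS; exists f.
by rewrite linear0 sub0r opprK.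
Qed.

(** How [cochain_step] acts on the values at a Koszul lift [a]: if these are
    [c] up to a Koszul boundary, the new ones are, up to a Koszul boundary, the
    quotient [c'] of the differential of [c] by [t]. *)
Lemma cochain_step_eval (I : Type) (w : I -> D) p (t : D) (s : seq D)
    (H : {linear free_res_obj N p -> D^o})
    (H' : {linear free_res_obj N p.+1 -> D^o})
    (a : seq I -> free_res_obj N p) (a' : seq I -> free_res_obj N p.+1)
    (c c' : seq I -> D^o) :
    (forall i j, w i * w j = w j * w i) ->
    (forall P : D, lideal s (P * t) -> lideal s P) ->
    (forall f, lideal s ((H (free_res_diff N p f) : D) - (H' f : D) * t)) ->
    (forall l, free_res_diff N p (a' l) = kdiff w a l) ->
    (forall l, lideal s ((kdiff w c l : D) - (c' l : D) * t)) ->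
    (exists b : seq I -> D^o,
       forall l, lideal (t :: s) ((H (a l) : D) - c l - kdiff w b l)) ->
  exists b : seq I -> D^o,
    forall l, lideal s ((H' (a' l) : D) - c' l - kdiff w b l).
Proof.
move=> ww reg HH' aa' cc' [b bP].
have /choice[b' b'P] l : exists Q : D,
  lideal s ((H (a l) : D) - c l - kdiff w b l - Q * t) by exact: bP.
exists b' => l; apply: reg.
have := lideal_kdiff w l b'P.
rewrite !(kdiffB, kdiffM) kdiff_kdiff // subr0.
rewrite -(kdiff_linear _ H) -aa'.
move=> /lidealD/(_ (cc' l))/lidealB/(_ (HH' (a' l))).
congr (lideal s _); rewrite !mulrBl.
set X : D := H _; set Y : D := kdiff w c l; set Z := _ * t; set U := _ * t.
set W := _ * t.
rewrite (addrA _ Y) (addrAC _ (- Z)) subrK opprB [LHS]addrC -!addrA addKr.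
by rewrite (addrC (- Z)).
Qed.

End Cochain.

(** * Regular sequences in the Weyl algebra *)

Section AdNilpotent.
Context (D : nzRingType) (y : D).

Definition ad_nilpotent (P : D) := exists N, iter N (ad y) P = 0.

Lemma ad_is_zmod : zmod_morphism (ad y).
Proof. by move=> P Q; rewrite /ad mulrBl mulrBr !opprD !opprK addrACA. Qed.
HB.instance Definition _ := GRing.isZmodMorphism.Build D D (ad y) ad_is_zmod.

Lemma iter_ad0 N : iter N (ad y) 0 = 0.
Proof. by elim: N => //= N ->; rewrite raddf0. Qed.

Lemma ad_nilpotentD P Q :
  ad_nilpotent P -> ad_nilpotent Q -> ad_nilpotent (P + Q).
Proof.
move=> [M HM] [N HN]; exists (M + N)%N.
have iter_adD R S k : iter k (ad y) (R + S) = iter k (ad y) R + iter k (ad y) S.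
  by elim: k => //= k ->; rewrite raddfD.
by rewrite iter_adD {1}addnC !iterD HM HN !iter_ad0 addr0.
Qed.

Lemma ad_nilpotentM g P :
  GRing.comm (ad y g) y -> ad_nilpotent P -> ad_nilpotent (g * P).
Proof.
have adM h Q : ad y (h * Q) = h * ad y Q + ad y h * Q.
  by rewrite /ad mulrBr mulrBl !mulrA addrA subrK.
have central c Q : GRing.comm c y -> ad_nilpotent Q -> ad_nilpotent (c * Q).
  move=> cy [N HN]; exists N.
  have -> : iter N (ad y) (c * Q) = c * iter N (ad y) Q.
    elim: N {HN} => //= N ->; rewrite adM [ad y c]/ad cy subrr mul0r addr0 //.
  by rewrite HN mulr0.
move=> gy [N]; elim: N P => [|N IH] P /= HP.
  by exists 0%N; rewrite /= HP mulr0.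
have [M HM] : ad_nilpotent (ad y (g * P)).
  rewrite adM; apply: ad_nilpotentD; first by apply: IH; rewrite -iterSr.
  by apply: central => //; exists N.+1.
by exists M.+1; rewrite iterSr.
Qed.
End AdNilpotent.

Section WeylRing.
Context (K : fieldType) (n : nat).
Local Notation W := (weyl K n).
Local Notation x_ := (@weyl_x K n).
Local Notation d_ := (@weyl_d K n).
Local Notation const := (@weyl_const K n).

(** The Weyl algebra is spanned by the products of generators, so a property
    stable under left multiplication by them holds everywhere. *)
Lemma weyl_gen_ind (S : W -> Prop) :
    S 1 -> (forall P Q, S P -> S Q -> S (P + Q)) ->
    (forall c P, S P -> S (const c * P)) ->
    (forall i P, S P -> S (x_ i * P)) -> (forall i P, S P -> S (d_ i * P)) ->
  forall P, S P.
Proof.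
move=> S1 SD Sc Sx Sd P; rewrite -[P]mulr1; elim/quotW: P => t.
elim: t 1 S1 => [c|i|i|t IH|t IHt u IHu|t IHt u IHu] Q SQ.
- exact: Sc.
- exact: Sx.
- exact: Sd.
- by rewrite weylN mulNr -mulN1r -(rmorphN1 const); apply/Sc/IH.
- by rewrite weylD mulrDl; apply: SD; [exact: IHt | exact: IHu].
- by rewrite weylM -mulrA; apply/IHt/IHu.
Qed.

Lemma weyl_xd i j : x_ i * d_ j = d_ j * x_ i - (j == i)%:R.
Proof. by rewrite weyl_dx addrK. Qed.

Lemma ad_x_nilpotent k P : ad_nilpotent (x_ k) P.
Proof.
elim/weyl_gen_ind: P => [|P Q|c P HP|i P HP|i P HP].
- by exists 1%N; rewrite /= /ad mulr1 mul1r subrr.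
- exact: ad_nilpotentD.
- by apply: ad_nilpotentM; rewrite // /ad weyl_constC subrr;
    exact/commr_sym/commr0.
- by apply: ad_nilpotentM; rewrite // /ad weyl_xxC subrr;
    exact/commr_sym/commr0.
- by apply: ad_nilpotentM; rewrite // /ad weyl_dx addrAC subrr add0r;
    exact/commr_sym/commr_nat.
Qed.

Lemma ad_opp_d_nilpotent k P : ad_nilpotent (- d_ k) P.
Proof.
elim/weyl_gen_ind: P => [|P Q|c P HP|i P HP|i P HP].
- by exists 1%N; rewrite /= /ad mulr1 mul1r subrr.
- exact: ad_nilpotentD.
- by apply: ad_nilpotentM; rewrite // /ad weyl_constC subrr;
    exact/commr_sym/commr0.
- apply: ad_nilpotentM; rewrite // /ad mulrN mulNr opprK weyl_xd opprB subrK.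
  exact/commr_sym/commr_nat.
- by apply: ad_nilpotentM; rewrite // /ad mulrN mulNr weyl_ddC subrr;
    exact/commr_sym/commr0.
Qed.

Hypothesis K0 : [pchar K] =i pred0.

Lemma weyl_nat_inv j : exists c : W, c * j.+1%:R = 1.
Proof.
exists (const j.+1%:R^-1).
rewrite -(rmorph_nat const) -rmorphM mulVf ?rmorph1 //.
by have /pcharf0P-> := K0.
Qed.

(** [lideal_regular] with [y = x_ i], as [d_ i] and [x_ i] have commutator 1. *)
Lemma lideal_d_regular i (js : seq 'I_n) (P : W) :
  i \notin js -> lideal (map d_ js) (P * d_ i) -> lideal (map d_ js) P.
Proof.
move=> ijs; apply: (lideal_regular (y := x_ i)).
- by rewrite weyl_dx eqxx.
- by move=> _ /mapP[j _ ->]; exact: weyl_ddC.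
- move=> _ /mapP[j jj ->]; rewrite weyl_dx.
  by case: eqVneq jj ijs => [->->|]; rewrite ?addr0.
- exact: ad_x_nilpotent.
- exact: weyl_nat_inv.
Qed.

Lemma lideal_x_regular i (js : seq 'I_n) (P : W) :
  i \notin js -> lideal (map d_ js) (P * x_ i) -> lideal (map d_ js) P.
Proof.
move=> ijs; apply: (lideal_regular (y := - d_ i)).
- by rewrite mulrN mulNr weyl_xd eqxx opprB addrC.
- move=> _ /mapP[j jj ->]; rewrite weyl_dx.
  by case: eqVneq jj ijs => [->->|]; rewrite ?addr0.
- by move=> _ /mapP[j _ ->]; rewrite mulrN mulNr weyl_ddC.
- exact: ad_opp_d_nilpotent.
- exact: weyl_nat_inv.
Qed.
End WeylRing.

(** * Cocycles from regular sequences *)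

Section KoszulIdeal.
Context (D : nzRingType) (I : finType) (w : I -> D).

(** By [kdiff_sum_ind] the differential is the sum of its components along the
    indices.  The component along [i] gives the main term, those along [js] lie
    in the left ideal, and the others vanish by the last hypothesis. *)
Lemma kdiff_lideal i (js : seq I) (t : D) (c c0 : seq I -> D^o) l :
    (forall k, w i * (c k : D) = (c0 k : D) * t) ->
    (forall j k, j != i -> w j * (c k : D) = (c k : D) * w j) ->
    (forall j k, j \notin i :: js -> kdiff (ind D j) c k = 0) ->
  lideal (map w js) ((kdiff w c l : D) - (kdiff (ind D i) c0 l : D) * t).
Proof.
move=> wi wj cj.
rewrite kdiff_sum_ind (bigD1 i) //= -kdiffM.
rewrite (eq_kdiff (ind D i) (b := fun k => (c0 k : D) * t : D^o)); last first.
  by move=> k; exact: wi.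
rewrite addrAC subrr add0r.
elim/big_ind: _ => [|P Q|j ji]; [exact: lideal0 | exact: lidealD |].
rewrite (eq_kdiff (ind D j) (b := fun k => (c k : D) * w j : D^o)); last first.
  by move=> k; exact: wj.
rewrite kdiffM; have [jjs|jjs] := boolP (j \in js).
  by apply: lideal_gen; exact: map_f.
by rewrite cj ?mul0r ?inE ?negb_or ?ji //; exact: lideal0.
Qed.

Lemma kdiff_central (a : seq I -> D^o) :
    (forall i P, w i * P = P * w i) ->
    (forall l (P : D), P * (a l : D) = (a l : D) * P) ->
  forall l (P : D), P * (kdiff w a l : D) = (kdiff w a l : D) * P.
Proof.
move=> wC aC l P; elim: l a aC => [|m l IH] a aC; first by rewrite mulr0 mul0r.
rewrite mulrBr mulrBl [X in _ - X]IH // -[_ *: _]/(w m * (a l : D)).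
by rewrite mulrA -wC -!mulrA aC.
Qed.

End KoszulIdeal.

Section Orient.
Context (D : nzRingType) (I : finType).

(** The exterior product of [c] with the coordinates listed in [s].  When [c]
    is the constant 1 and [s] has no duplicates, its value on a permutation of
    [s] is a sign. *)
Definition orient (s : seq I) (c : seq I -> D^o) : seq I -> D^o :=
  foldl (fun c i => kdiff (ind D i) c) c s.

Lemma orientZ s (a : D) (c : seq I -> D^o) l :
  orient s (fun k => a *: c k) l = a *: orient s c l.
Proof.
elim: s c => //= i s IH c; rewrite /orient /= -/(orient s _) -IH.
congr (orient s _ l); apply: funext => k.
by apply: kdiffZ => j; exact: ind_central.
Qed.

Lemma orient_rev s (c : seq I -> D^o) l :
  uniq (rev s ++ l) -> orient s c (rev s ++ l) = c l.
Proof.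
elim: s c l => //= i s IH c l; rewrite rev_cons cat_rcons => uil.
rewrite /orient /= -/(orient s _) IH // kdiff_ind_cons //.
by move: uil; rewrite cat_uniq /= => /and3P[_ _ /andP[]].
Qed.
End Orient.

Section Chain.
Context (K : fieldType) (n : nat).
Hypothesis K0 : [pchar K] =i pred0.
Local Notation W := (weyl K n).
Local Notation x_ := (@weyl_x K n).
Local Notation d_ := (@weyl_d K n).
Local Notation const := (@weyl_const K n).
Context (N : lmodType W).

(** All partials in [ks] are removed one after the other by [cochain_step].
    The condition on [kdiff (ind W j) c] says that [c] is divisible, in the
    exterior algebra, by the coordinates of the indices removed so far. *)
Lemma koszul_chain (ks : seq 'I_n) p m (H : {linear free_res_obj N p -> W^o}) :
    m = (p + size ks)%N -> uniq ks ->
    (forall f, lideal (map d_ ks) (H (free_res_diff N p f) : W)) ->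
  exists z : {linear free_res_obj N m -> W^o},
    (forall f, z (free_res_diff N m f) = 0) /\
    forall (a : forall q, seq 'I_n -> free_res_obj N q) (c : seq 'I_n -> W^o),
      (forall q l, free_res_diff N q (a q.+1 l) = kdiff d_ (a q) l) ->
      (forall l (P : W), P * (c l : W) = (c l : W) * P) ->
      (forall j l, j \notin ks -> kdiff (ind W j) c l = 0) ->
      (exists b : seq 'I_n -> W^o, forall l,
         lideal (map d_ ks) ((H (a p l) : W) - c l - kdiff d_ b l)) ->
      exists b : seq 'I_n -> W^o, forall l,
        (z (a m l) : W) =
        orient ks c l + kdiff d_ b l.
Proof.
have dd i j : d_ i * d_ j = d_ j * d_ i by exact: weyl_ddC.
elim: ks p m H => [|i ks IH] p m H.
  rewrite addn0 => -> _ Hd; exists H; split=> // a c _ _ _ [b Hb].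
  by exists b => l; move/eqP: (Hb l); rewrite /= -addrA -opprD subr_eq0 => /eqP.
rewrite [size _]/= -addSnnS cons_uniq => mE /andP[iis uis] Hd.
have reg P : lideal (map d_ ks) (P * d_ i) -> lideal (map d_ ks) P.
  exact: lideal_d_regular.
have [H' [H'd HH']] := cochain_step reg Hd.
have [z [zd zE]] := IH _ _ _ mE uis H'd.
exists z; split=> // a c aP cC cis Hb.
apply: (zE a _ aP).
- by apply: kdiff_central => // j P; exact: ind_central.
- move=> j l jis; have [->|ji] := eqVneq j i.
    by apply: kdiff_kdiff => j' k; exact: ind_central.
  rewrite kdiff_comm => [|j' k]; last exact: ind_central.
  rewrite (eq_kdiff (ind W i) (b := fun=> 0)) => [|k]; last first.
    by apply: cis; rewrite inE negb_or ji.
  by rewrite kdiff_const ?oppr0 // => k; rewrite scaler0.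
- apply: (cochain_step_eval dd reg HH' (aP p)) Hb => l.
  apply: kdiff_lideal => [k|j k _|j k jis]; [exact: cC | exact: cC |].
  exact: cis.
Qed.

(** [H] is a lift of a map from [N] to [D/D(d_e x_e, d_k)], that is to
    [K[x, 1/x_e]], where [1/x_e] is the generator.  A flat element sent there
    to [c] has the representative [c x_e], which the first step divides by
    [d_e x_e], leaving the constant [c] in the direction [e]. *)
Lemma koszul_cocycle e (ks : seq 'I_n) (H : {linear free_res_obj N 0 -> W^o}) :
    uniq (e :: ks) -> e :: ks =i predT ->
    (forall f,
       lideal (d_ e * x_ e :: map d_ ks) (H (free_res_diff N 0 f) : W)) ->
  exists z : {linear free_res_obj N n -> W^o},
    (forall f, z (free_res_diff N n f) = 0) /\
    forall (v : N) (c : K), (forall i, d_ i *: v = 0) ->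
      lideal (d_ e * x_ e :: map d_ ks)
        ((H (free_gen W v) : W) - const c * x_ e) ->
      exists b : seq 'I_n -> W^o, forall l,
        (z (koszul_lift d_ v n l) : W) =
        const c * orient (e :: ks) (fun=> 1) l + kdiff d_ b l.
Proof.
rewrite cons_uniq => /andP[eis uis] eisT Hd.
have dd i j : d_ i * d_ j = d_ j * d_ i by exact: weyl_ddC.
have nE : n = (1 + size ks)%N.
  transitivity #|e :: ks|; first by rewrite (eq_card eisT) card_ord.
  by apply/card_uniqP; rewrite /= eis.
have reg P : lideal (map d_ ks) (P * (d_ e * x_ e)) -> lideal (map d_ ks) P.
  by rewrite mulrA => /(lideal_x_regular K0 eis)/(lideal_d_regular K0 eis).
have [H' [H'd HH']] := cochain_step reg Hd.
have [z [zd zE]] := koszul_chain nE uis H'd.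
exists z; split=> // v c v0 Hv.
have aP q l := koszul_liftP q l dd v0.
(* the direction e: [d_e (c x_e)] is [c] times the generator [d_e x_e] *)
pose c0 (l : seq 'I_n) : W^o := const c.
have [|||b zb] := zE (koszul_lift d_ v) (kdiff (ind W e) c0) aP.
- apply: kdiff_central => [j P|l P]; first exact: ind_central.
  by rewrite /c0 weyl_constC.
- move=> j l; have [->|je jis] := eqVneq j e.
    by move=> _; apply: kdiff_kdiff => j' k; exact: ind_central.
  by have := eisT j; rewrite !inE (negbTE je) (negbTE jis).
- pose c1 (l : seq 'I_n) : W^o := const c * x_ e.
  apply: (cochain_step_eval (c := c1) dd reg HH' (aP 0%N)).
    move=> l; apply: kdiff_lideal => [k|j k je|j k].
    + by rewrite /c1 /c0 mulrA -weyl_constC mulrA.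
    + by rewrite /c1 mulrA -weyl_constC -mulrA weyl_dx (negbTE je) addr0 mulrA.
    + by rewrite eisT.
  exists (fun=> 0) => l.
  by rewrite kdiff_const ?subr0 // => k; rewrite scaler0.
exists b => l; rewrite zb; congr (_ + _).
rewrite -[_ * _]/(const c *: _) -orientZ.
rewrite -[RHS]/(orient ks (kdiff (ind W e) (fun=> const c *: (1 : W^o))) l).
congr (orient ks _ l); apply: funext => k; apply: eq_kdiff => k'.
by rewrite /c0 -[_ *: _]/(_ * _) mulr1.
Qed.
End Chain.

(** * Polynomial solutions of GKZ-systems *)

Section Action.
Context (K : fieldType) (n : nat).
Local Notation W := (weyl K n).
Local Notation x_ := (@weyl_x K n).
Local Notation d_ := (@weyl_d K n).
Local Notation const := (@weyl_const K n).
Implicit Types (P Q : W) (q : {mpoly K[n]}).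

Definition act P : {mpoly K[n]} -> {mpoly K[n]} := wact (repr P).

Lemma act_pi t : act (\pi_W t) =1 wact t.
Proof. exact: wact_weq (weq_repr t). Qed.

Lemma act_is_linear P : linear (act P).
Proof. by move=> a p q; exact: wact_linear. Qed.
HB.instance Definition _ P := GRing.isLinear.Build K {mpoly K[n]} {mpoly K[n]}
  *:%R (act P) (act_is_linear P).

Lemma actM P Q q : act (P * Q) q = act P (act Q q).
Proof. by rewrite -[P]reprK -[Q]reprK -weylM !act_pi. Qed.

(** The arguments of [act] are exchanged so that additivity in the operator can
    be declared. *)
Definition act_on q P := act P q.

Lemma act_on_zmod q : zmod_morphism (act_on q).
Proof.
by move=> P Q; rewrite /act_on -[P]reprK -[Q]reprK -weylN -weylD !act_pi.
Qed.
HB.instance Definition _ q := GRing.isZmodMorphism.Build W {mpoly K[n]}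
  (act_on q) (act_on_zmod q).

Lemma act_const c q : act (const c) q = c *: q.
Proof. exact: act_pi. Qed.
Lemma act1 q : act 1 q = q.
Proof. by rewrite -[1]/(const 1) act_const scale1r. Qed.
Lemma act_x i q : act (x_ i) q = 'X_i * q.
Proof. exact: act_pi. Qed.
Lemma act_d i q : act (d_ i) q = q^`M(i).
Proof. exact: act_pi. Qed.

Lemma act_monom (m : 'X_{1..n}) q : act (mmap1 d_ m) q = q^`M[m].
Proof.
have -> : mderivm m q = foldr (fun i => iter (m i) (mderiv i)) q (index_enum _).
  by rewrite /mderivm enumT /index_enum; case: index_enum_key.
rewrite /mmap1; elim: (index_enum _) => [|i s IH].
  by rewrite big_nil act1.
rewrite big_cons actM IH /=; elim: (m i) => [|k IHk] /=.
  by rewrite expr0 act1.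
by rewrite exprS actM IHk act_d.
Qed.

Lemma act_diff_opX m q : act (diff_op 'X_[m]) q = q^`M[m].
Proof. by rewrite /diff_op mmapX act_monom. Qed.

Lemma act_euler d (A : 'M[int]_(d, n)) i q m :
  (act (euler K A i) q)@_m = (\sum_j A i j * (m j)%:Z)%:~R * q@_m.
Proof.
have actE (k : 'X_{1..n}) : act (euler K A i) 'X_[k] =
    (\sum_j A i j * (k j)%:Z)%:~R *: 'X_[k].
  rewrite -[LHS]/(act_on 'X_[k] _) raddf_sum rmorph_sum scaler_suml.
  apply: eq_bigr => j _; rewrite /= /act_on -(rmorph_int const).
  rewrite !actM act_const act_x act_d.
  rewrite mderivX rmorphM -scalerA -scalerAr; congr (_ *: _).
  have [->|k0] := eqVneq (k j) 0%N; first by rewrite !scale0r.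
  by congr (_ *: _); rewrite -mpolyXD addmC submK // lep1mP.
rewrite {1}[q]mpolyE linear_sum raddf_sum /=.
have -> : q@_m = \sum_(k <- msupp q) (q@_k *: 'X_[k])@_m.
  by rewrite -raddf_sum -mpolyE.
rewrite mulr_sumr; apply: eq_bigr => k _.
rewrite linearZ /= actE !mcoeffZ mcoeffX mulrCA.
by have [->//|] := eqVneq k m; rewrite !mulr0.
Qed.
End Action.

Section Toric.
Context (K : fieldType) (d n : nat) (A : 'M[int]_(d, n)).

Definition toric_degree (m : 'X_{1..n}) (i : 'I_d) : int :=
  \sum_j A i j * (m j)%:Z.

Lemma toric_mapE :
  @toric_map K d n A = mmap (@tofrac {mpoly K[d]} \o @mpolyC d K)
       (fun j => \prod_(i < d) tofrac 'X_i ^ A i j).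
Proof. by []. Qed.

Lemma toric_mapX m :
  toric_map A ('X_[m] : {mpoly K[n]}) =
  \prod_i tofrac ('X_i : {mpoly K[d]}) ^ toric_degree m i.
Proof.
rewrite toric_mapE mmapX /mmap1.
rewrite (eq_bigr _ (fun j _ => esym (prodrXl _ _ _ _))) exchange_big /=.
apply: eq_bigr => i _.
rewrite /toric_degree.
elim/big_ind2: _ => [|e1 e2 f1 f2 -> ->|j _]; first by rewrite expr0z.
  rewrite expfzDr // tofrac_eq0; apply/eqP => /(congr1 (mcoeff U_(i)%MM)).
  by rewrite mcoeffXU eqxx mcoeff0 => /eqP; rewrite oner_eq0.
by rewrite -exprz_exp.
Qed.

Lemma toric_binomial m m' : toric_degree m =1 toric_degree m' ->
  toric_ideal A ('X_[m] - 'X_[m'] : {mpoly K[n]}).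
Proof.
move=> mm'; rewrite /toric_ideal toric_mapE mmapB -toric_mapE !toric_mapX.
by rewrite (eq_bigr _ (fun i _ => congr1 _ (mm' i))) subrr.
Qed.
End Toric.

Section PolynomialSolutions.
Context (K : fieldType) (d n : nat) (B : 'M[int]_(d, n)) (beta : 'cV[K]_d).
Hypothesis K0 : [pchar K] =i pred0.

Definition gkz_solution (q : {mpoly K[n]}) :=
  forall P, gkz_relation B beta P -> act P q = 0.

Lemma gkz_solution_degree q m i :
  gkz_solution q -> m \in msupp q -> (toric_degree B m i)%:~R = beta i 0.
Proof.
move=> qs; rewrite mcoeff_msupp => qm.
have /(congr1 (mcoeff m)) := qs _ (gkz_euler B beta i).
rewrite -[act _ _]/(act_on q _) raddfB /= /act_on act_const.
rewrite mcoeffB act_euler mcoeffZ mcoeff0.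
by rewrite -mulrBl => /eqP; rewrite mulf_eq0 (negbTE qm) orbF subr_eq0 => /eqP.
Qed.

(** Apply [d^m - d^m'] and take the constant term. *)
Lemma gkz_solution_coef q m m' :
  gkz_solution q -> toric_degree B m =1 toric_degree B m' ->
  q@_m * (\prod_(i < n) (m i)`!)%:R = q@_m' * (\prod_(i < n) (m' i)`!)%:R.
Proof.
move=> qs mm'.
have /(congr1 (mcoeff 0%MM)) := qs _ (gkz_toric beta (toric_binomial K mm')).
rewrite -[act _ _]/(act_on q _) /diff_op mmapB raddfB /= /act_on.
rewrite !act_diff_opX mcoeffB mcoeff0.
rewrite !mcoeff_mderivm !addm0 => /eqP; rewrite subr_eq0 => /eqP.
have E (k : 'X_{1..n}) :
    (\prod_(i < n) (k i) ^_ (k i) = \prod_(i < n) (k i)`!)%N.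
  by apply: eq_bigr => i _; rewrite ffactnn.
by rewrite !E !mulr_natr.
Qed.

(** All exponents of both solutions lie in one fibre of the degree map, and
    there [gkz_solution_coef] determines a solution by one coefficient. *)
Lemma gkz_solution_unique q1 q2 :
  gkz_solution q1 -> gkz_solution q2 ->
  exists c : K * K, c != 0 /\ c.1 *: q1 + c.2 *: q2 = 0.
Proof.
move=> s1 s2; have [->|q1n0] := eqVneq q1 0.
  exists (1, 0); split; last by rewrite scaler0 scale0r addr0.
  by rewrite -pair_eqE /= oner_eq0.
have [m q1m] : exists m, m \in msupp q1.
  have : msupp q1 != [::] by rewrite msupp_eq0.
  by case: (msupp q1) => // m s _; exists m; rewrite mem_head.
exists (q2@_m, - q1@_m); split.
  by rewrite -pair_eqE negb_and /= oppr_eq0 -!mcoeff_msupp q1m orbT.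
apply/mpolyP => k; rewrite mcoeffD !mcoeffZ mcoeff0 /=.
have [kq|] := boolP ((k \in msupp q1) || (k \in msupp q2)); last first.
  rewrite negb_or -!mcoeff_eq0 => /andP[/eqP-> /eqP->].
  by rewrite !mulr0 addr0.
have mk i : toric_degree B m i = toric_degree B k i.
  have inj : injective (fun z : int => z%:~R : K).
    move=> y z /eqP; rewrite -subr_eq0 -rmorphB => yz.
    apply/eqP; rewrite -subr_eq0; move: (y - z) yz => [u|u] /=.
      by rewrite -pmulrn; have /pcharf0P-> := K0.
    by rewrite NegzE mulrNz oppr_eq0 -pmulrn; have /pcharf0P-> := K0.
  apply: inj; rewrite (gkz_solution_degree i s1 q1m).
  by case/orP: kq => kq; rewrite (gkz_solution_degree i _ kq).
have e1 := gkz_solution_coef s1 mk; have e2 := gkz_solution_coef s2 mk.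
have f0 : (\prod_(i < n) (k i)`!)%:R != 0 :> K.
  have /pcharf0P-> := K0; rewrite -lt0n prodn_gt0 // => i; exact: fact_gt0.
apply: (mulIf f0); rewrite mul0r mulrDl -!mulrA -e1 -e2 mulNr.
by rewrite [X in _ - X]mulrCA addrN.
Qed.
End PolynomialSolutions.

(** * Cochains on a cyclic module *)

Section QuotientModule.
Context (D : nzRingType) (V : lmodType D) (S : V -> Prop).

Lemma lquot_eq0 (v : V) : \pi_(lquot S) v = 0 <-> spanned S v.
Proof.
have -> : (0 : lquot S) = \pi_(lquot S) 0 by rewrite raddf0.
split=> [/eqP|Sv]; last apply/eqP.
  by rewrite -Quotient.idealrBE subr0 => /asboolP.
by rewrite -Quotient.idealrBE subr0; exact/asboolP.
Qed.

Lemma lquot_scaleE (a : D) (v : V) :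
  a *: \pi_(lquot S) v = \pi_(lquot S) (a *: v).
Proof. by rewrite -[LHS]/(lquot_scale a _) -pi_lquot_scale. Qed.

Lemma spanned_gen v : S v -> spanned S v.
Proof.
by move=> Sv; rewrite -[v]addr0 -[v]scale1r; apply: spannedZD => //;
  constructor.
Qed.

Lemma spannedP a u v : spanned S u -> spanned S v -> spanned S (a *: u + v).
Proof.
move=> /asboolP Su /asboolP Sv; apply/asboolP.
by have [_] := lspan_submod_closed S; apply.
Qed.

Lemma spannedD u v : spanned S u -> spanned S v -> spanned S (u + v).
Proof. by rewrite -{2}[u]scale1r; exact: spannedP. Qed.

Lemma spannedZ a v : spanned S v -> spanned S (a *: v).
Proof. by rewrite -[a *: v]addr0 => Sv; apply: spannedP => //; constructor. Qed.

Lemma spanned_sum (I : Type) (r : seq I) (F : I -> V) :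
  (forall i, spanned S (F i)) -> spanned S (\sum_(i <- r) F i).
Proof.
by move=> SF; elim/big_ind: _ => //; [constructor | exact: spannedD].
Qed.
End QuotientModule.

Section Cyclic.
Context (D : nzRingType) (S : D^o -> Prop) (s : seq D) (q : D).
Hypothesis Sq : forall r, S r -> lideal s ((r : D) * q).

Lemma spanned_lideal v : spanned S v -> lideal s ((v : D) * q).
Proof.
elim=> [|a u w Su _ IH]; first by rewrite mul0r; exact: lideal0.
have -> : (a *: u + w : D^o) * q = a * ((u : D) * q) + (w : D) * q :> D.
  by rewrite mulrDl -mulrA.
by apply: lidealP => //; exact: Sq.
Qed.

(** The map from the cyclic module [D/DS] to [D/s] that sends the generator to
    the class of [q], lifted to the free cover. *)
Lemma cyclic_cochain :
  exists H : {linear free_res_obj (lquot S) 0 -> D^o},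
    (forall f, lideal s (H (free_res_diff (lquot S) 0 f) : D)) /\
    forall (P : D^o) c, lideal s ((P : D) * q - c) ->
      lideal s ((H (free_gen D (\pi_(lquot S) P)) : D) - c).
Proof.
pose rho : {linear free_mod D (lquot S) -> D^o} :=
  [the {linear _ -> _} of free_lift (fun N => repr N : D^o)].
pose h f : D^o := (rho f : D) * q.
have hlin : linear h.
  move=> a x y; rewrite /h linearP.
  by rewrite -[a *: rho x]/(a * (rho x : D)) mulrDl -mulrA.
pose hL : GRing.isLinear _ _ _ _ h := GRing.isLinear.Build _ _ _ _ h hlin.
pose H : {linear free_mod D (lquot S) -> D^o} := HB.pack h hL.
have piL : linear \pi_(lquot S).
  by move=> a x y; rewrite raddfD lquot_scaleE.
pose piL' : GRing.isLinear _ _ _ _ \pi_(lquot S) :=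
  GRing.isLinear.Build _ _ _ _ \pi_(lquot S) piL.
pose piH : {linear D^o -> lquot S} := HB.pack \pi_(lquot S) piL'.
have rhoE : piH \o rho =1 free_cover (lquot S).
  apply: (free_mod_ext (f := [the {linear _ -> _} of piH \o rho])) => x.
  by rewrite /= !free_liftU reprK.
exists H; split=> [f|P c HP].
  apply: spanned_lideal; apply/lquot_eq0.
  rewrite -[LHS]/((piH \o rho) _) rhoE.
  by apply/(free_res_exact (i := 0)); exists f.
have -> : (H (free_gen D (\pi_(lquot S) P)) : D) - c =
    ((repr (\pi_(lquot S) P) - P : D^o) : D) * q + ((P : D) * q - c).
  by rewrite -[H _]/(h _) /h /rho /= free_liftU mulrBl addrA subrK.
apply: lidealD HP; apply: spanned_lideal; apply/lquot_eq0.
by rewrite raddfB /= reprK subrr.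
Qed.
End Cyclic.

(** * Flat elements of a GKZ-system *)

Section Monomials.
Context (K : fieldType) (n : nat).
Local Notation W := (weyl K n).
Local Notation x_ := (@weyl_x K n).
Local Notation d_ := (@weyl_d K n).
Local Notation const := (@weyl_const K n).

Definition dmon (m : 'X_{1..n}) : W := mmap1 d_ m.

Lemma dmonD m m' : dmon (m + m')%MM = dmon m * dmon m'.
Proof.
rewrite /dmon /mmap1 -prodrM_comm => [|i j _ _]; last first.
  exact/commrX/commr_sym/commrX/weyl_ddC.
by apply: eq_bigr => i _; rewrite mnmDE exprD.
Qed.

Lemma dmonU i : dmon U_(i) = d_ i.
Proof. exact: mmap1U. Qed.

Lemma diff_opX m : diff_op 'X_[m] = dmon m.
Proof. exact: mmapX. Qed.

Lemma dmon_split (m : 'X_{1..n}) i : (0 < m i)%N ->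
  dmon m = dmon (m - U_(i))%MM * d_ i.
Proof. by move=> mi; rewrite -dmonU -dmonD submK // lep1mP -lt0n. Qed.

Lemma dmon_theta (m : 'X_{1..n}) j :
  dmon m * (x_ j * d_ j) = (x_ j * d_ j + (m j)%:R) * dmon m.
Proof.
have dE i : d_ i * (x_ j * d_ j) = (x_ j * d_ j + (i == j)%:R) * d_ i.
  rewrite mulrA weyl_dx !mulrDl -!mulrA (weyl_ddC _ i j).
  by congr (_ + _); case: eqVneq => [->//|_]; rewrite !mul0r.
have dXE i k : d_ i ^+ k * (x_ j * d_ j) =
    (x_ j * d_ j + ((i == j) * k)%:R) * d_ i ^+ k.
  elim: k => [|k IH]; first by rewrite muln0 expr0 addr0 mul1r mulr1.
  rewrite exprSr -mulrA dE mulrA mulrDr IH commr_nat.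
  rewrite -mulrDl -addrA -natrD -mulrA -exprSr.
  by congr ((_ + _%:R) * _); rewrite mulnS addnC.
have -> : m j = (\sum_i (i == j) * m i)%N.
  by rewrite (bigD1 j) //= eqxx mul1n big1 ?addn0 // => i /negbTE->.
rewrite /dmon /mmap1; elim: (index_enum _) => [|i s IH].
  by rewrite !big_nil addr0 mul1r mulr1.
rewrite !big_cons -mulrA IH mulrA mulrDr dXE commr_nat.
by rewrite -mulrDl -addrA -natrD mulrA.
Qed.

(** Monomials in the partials are homogeneous for the Euler operators. *)
Lemma dmon_euler d (A : 'M[int]_(d, n)) r m :
  dmon m * euler K A r = (euler K A r + (toric_degree A m r)%:~R) * dmon m.
Proof.
rewrite /euler /toric_degree mulr_sumr rmorph_sum -big_split mulr_suml /=.
apply: eq_bigr => j _.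
rewrite -(mulrA _ (x_ j)) mulrA commr_int -mulrA dmon_theta.
by rewrite rmorphM -mulrDr mulrA.
Qed.
End Monomials.

Section FlatElements.
Context (K : fieldType) (d n : nat) (A : 'M[int]_(d, n)) (beta : 'cV[K]_d).
Local Notation W := (weyl K n).
Local Notation x_ := (@weyl_x K n).
Local Notation d_ := (@weyl_d K n).

(** If [b] is a gap of the semigroup and [m j] has degree [a_j + b], this is
    the image of [t^b] under the Euler operator [E_r - b_r], computed as if
    [t^b] belonged to the semigroup ring. *)
Definition euler_class (m : 'I_n -> 'X_{1..n}) r : W :=
  \sum_j (A r j)%:~R * x_ j * dmon K (m j).

(** [d_i] times the class equals [d^(m i) (E_r - b_r)] up to the binomials
    [d_i d^(m j) - d_j d^(m i)], which are toric because both monomials have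
    degree [a_i + a_j + b]. *)
Lemma euler_class_flat (b : 'I_d -> int) (m : 'I_n -> 'X_{1..n}) r i :
    (forall r, beta r 0 = (b r)%:~R) ->
    (forall i r, toric_degree A (m i) r = A r i + b r) ->
  d_ i *: \pi_(gkz A beta) (euler_class m r : W^o) = 0.
Proof.
move=> bE mE; rewrite lquot_scaleE; apply/lquot_eq0.
have -> : d_ i *: (euler_class m r : W^o) =
    dmon K (m i) *: (euler K A r - weyl_const n (beta r 0) : W^o) +
    \sum_j ((A r j)%:~R * x_ j) *:
       (diff_op ('X_[U_(i) + m j] - 'X_[U_(j) + m i]) : W^o).
  rewrite -[LHS]/(d_ i * euler_class m r) -[_ *: _]/(_ * _).
  rewrite (eq_bigr (fun j => (A r j)%:~R * x_ j *
      (dmon K (U_(i) + m j)%MM - dmon K (U_(j) + m i)%MM) : W^o)); last first.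
    by move=> j _; rewrite /diff_op mmapB -!/(diff_op _) !diff_opX.
  set M := dmon K (m i).
  under [X in _ = _ + X]eq_bigr do rewrite mulrBr !dmonD !dmonU.
  rewrite sumrB mulrBr dmon_euler mE bE rmorph_int.
  have -> : \sum_j (A r j)%:~R * x_ j * (d_ j * M) = euler K A r * M.
    by rewrite mulr_suml; apply: eq_bigr => j _; rewrite mulrA.
  have -> : d_ i * euler_class m r = (A r i)%:~R * M +
      \sum_j (A r j)%:~R * x_ j * (d_ i * dmon K (m j)).
    have dE j : d_ i * ((A r j)%:~R * x_ j * dmon K (m j)) =
        (i == j)%:R * ((A r j)%:~R * dmon K (m j)) +
        (A r j)%:~R * x_ j * (d_ i * dmon K (m j)).
      rewrite !mulrA (commr_int (d_ i)) -(mulrA _ (d_ i) (x_ j)) weyl_dx.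
      rewrite mulrDr mulrDl addrC.
      by rewrite !mulrA (commr_nat _ (i == j)).
    rewrite /euler_class mulr_sumr (eq_bigr _ (fun j _ => dE j)) big_split /=.
    congr (_ + _); rewrite (bigD1 i) //= eqxx mul1r big1 ?addr0 // => j.
    by rewrite eq_sym => /negbTE->; rewrite mul0r.
  rewrite commr_int -/M (rmorphD (intmul 1 : int -> W)) /=.
  rewrite 2!mulrDl (addrA (_ * M) (_ * M)) addrK.
  by rewrite [in RHS](addrC (_ * M)) -addrA [X in _ = _ + X]addrCA subrr addr0.
apply: spannedD; first by apply/spannedZ/spanned_gen; constructor.
apply: spanned_sum => j; apply/spannedZ/spanned_gen; constructor.
apply: toric_binomial => k.
rewrite /toric_degree; under eq_bigr do rewrite mnmDE PoszD mulrDr.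
under [RHS]eq_bigr do rewrite mnmDE PoszD mulrDr.
rewrite !big_split /= -!/(toric_degree A _ k) !mE.
have degU l : toric_degree A U_(l)%MM k = A k l.
  rewrite /toric_degree (bigD1 l) //= mnm1E eqxx mulr1 big1 ?addr0 // => u.
  by rewrite mnm1E eq_sym => /negbTE->; rewrite mulr0.
by rewrite !degU addrCA.
Qed.
End FlatElements.

(** * Laurent monomial solutions *)

(** The coefficients of a toric polynomial add up to zero on each fibre of the
    degree map, hence vanish on the fibres with one element.  With nonnegative
    entries the toric map takes its values in the polynomials. *)
Lemma toric_ideal_coef (K : fieldType) d n (A : 'M[int]_(d, n))
    (A' : 'I_d -> 'I_n -> nat) (p : {mpoly K[n]}) (m : 'X_{1..n}) :
    (forall i j, A i j = (A' i j)%:Z) -> toric_ideal A p ->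
    (forall m', toric_degree A m' =1 toric_degree A m -> m' = m) ->
  p@_m = 0.
Proof.
move=> AA' pI fib.
pose deg (m : 'X_{1..n}) := [multinom (\sum_j A' i j * m j)%N | i < d].
have degE m' i : toric_degree A m' i = (deg m' i)%:Z.
  rewrite mnmE /toric_degree (big_morph Posz PoszD (erefl 0%:Z)).
  by apply: eq_bigr => j _; rewrite AA'.
have mapX m' : toric_map A ('X_[m'] : {mpoly K[n]}) = tofrac 'X_[deg m'].
  rewrite toric_mapX mpolyXE_id rmorph_prod /=; apply: eq_bigr => i _.
  by rewrite degE -exprnP rmorphXn.
have mapE : toric_map A p = tofrac (\sum_(m' <- msupp p) p@_m' *: 'X_[deg m']).
  rewrite {1}[p]mpolyE toric_mapE raddf_sum raddf_sum /=.
  apply: eq_bigr => m' _; rewrite mmapZ -toric_mapE mapX /=.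
  by rewrite -mul_mpolyC tofracM.
move: pI; rewrite /toric_ideal mapE => /eqP; rewrite tofrac_eq0 => /eqP.
move=> /(congr1 (mcoeff (deg m))); rewrite raddf_sum mcoeff0 /= => sum0.
have [mp|] := boolP (m \in msupp p); last by rewrite -mcoeff_eq0 => /eqP.
rewrite -[RHS]sum0 (bigD1_seq m) ?msupp_uniq //= mcoeffZ mcoeffX eqxx mulr1.
rewrite big1 ?addr0 // => m' mm'; rewrite mcoeffZ mcoeffX.
have [dd|] := eqVneq; last by rewrite mulr0.
by rewrite (fib m') ?eqxx // in mm' => i; rewrite !degE dd.
Qed.

(** In [D/D(d_e x_e, d_k : k in ks)], the module [K[x, 1/x_e]], the class of
    [P q] is [P] applied to the Laurent monomial [x_f^2/x_e]. *)
Section Laurent.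
Context (K : fieldType) (n : nat).
Local Notation W := (weyl K n).
Local Notation x_ := (@weyl_x K n).
Local Notation d_ := (@weyl_d K n).
Local Notation const := (@weyl_const K n).
Context (e f : 'I_n) (ks : seq 'I_n).
Hypotheses (ef : e != f) (eks : e :: ks =i predT).
Local Notation s := (d_ e * x_ e :: map d_ ks).
Local Notation q := (x_ f * x_ f).

Lemma laurent_d k P : k != e -> lideal s (P * d_ k).
Proof.
move=> ke; apply: lideal_gen; rewrite inE; apply/orP; right; apply: map_f.
by have := eks k; rewrite inE (negbTE ke) /= => ->.
Qed.

Lemma laurent_theta P : lideal s (P * (d_ e * x_ e)).
Proof. by apply: lideal_gen; rewrite mem_head. Qed.

Lemma d_comm_q k : k != f -> d_ k * q = q * d_ k.
Proof.
move=> /negbTE kf; rewrite mulrA weyl_dx kf addr0 -mulrA weyl_dx kf addr0.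
exact: mulrA.
Qed.

Lemma d_q : d_ f * q = q * d_ f + (x_ f + x_ f).
Proof.
rewrite mulrA weyl_dx eqxx mulrDl mul1r -mulrA weyl_dx eqxx mulrDr mulr1.
by rewrite mulrA addrA.
Qed.

Lemma dd_q : exists P, d_ f * (d_ f * q) = P * d_ f + 2%:R.
Proof.
exists (d_ f * q + (x_ f + x_ f)).
rewrite [in LHS]d_q mulrDr mulrA mulrDl -addrA.
by congr (_ + _); rewrite mulrDr weyl_dx eqxx mulrDl addrACA.
Qed.

Lemma laurent_dd_q : lideal s (d_ f * (d_ f * q) - 2%:R).
Proof.
have [P ->] := dd_q; rewrite addrK; apply: laurent_d.
by rewrite eq_sym.
Qed.

Lemma laurent_dmon_other (m : 'X_{1..n}) k :
  k != e -> k != f -> (0 < m k)%N -> lideal s (dmon K m * q).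
Proof.
move=> ke kf mk; rewrite (dmon_split _ mk) -mulrA d_comm_q // mulrA.
exact: laurent_d.
Qed.

Lemma laurent_dmon_cube (m : 'X_{1..n}) :
  (2 < m f)%N -> lideal s (dmon K m * q).
Proof.
move=> mf.
rewrite -(submK (m := U_(f) + (U_(f) + U_(f))) (m' := m)); last first.
  apply/mnm_lepP => i; rewrite !mnmDE mnm1E.
  by case: eqVneq mf => [<-|]; rewrite ?addn0 //.
rewrite !dmonD !dmonU -!mulrA; apply: lidealM.
have [P ->] := dd_q; rewrite mulrDr mulrA commr_nat.
by apply: lidealD; apply: laurent_d; rewrite eq_sym.
Qed.

(** The Laurent monomial [x_f^2/x_e] has degree [2 a_f - a_e]. *)
Lemma laurent_euler d (A : 'M[int]_(d, n)) r :
  lideal s (euler K A r * q - (A r f *+ 2 - A r e)%:~R * q).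
Proof.
pose c j : int := if j == f then A r f *+ 2 else if j == e then - A r e else 0.
have cE : A r f *+ 2 - A r e = \sum_j c j.
  rewrite (bigD1 f) //= (bigD1 e) //= /c eqxx (negbTE ef) eqxx big1 ?addr0 //.
  by move=> j /andP[/negbTE-> /negbTE->].
rewrite cE rmorph_sum mulr_suml mulr_suml -sumrB /=.
apply: lideal_sum => j _.
rewrite /c; case: (eqVneq j f) => [->|jf].
  rewrite -!mulrA d_q !mulrDr mulr2n intrD mulrDl -addrA subrr addr0 !mulrA.
  by apply: laurent_d; rewrite eq_sym.
case: (eqVneq j e) => [->|je]; last first.
  rewrite mulr0z mul0r subr0 -!mulrA d_comm_q // !mulrA.
  exact: laurent_d.
rewrite mulrNz mulNr opprK -!mulrA -mulrDr; apply: lidealM.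
have -> : x_ e * (d_ e * q) + q = q * (d_ e * x_ e).
  rewrite d_comm_q // weyl_dx eqxx mulrDr mulr1; congr (_ + _).
  by rewrite !mulrA (weyl_xxC _ e) -(mulrA (x_ f)) (weyl_xxC _ e) mulrA.
exact: laurent_theta.
Qed.

End Laurent.

(** * Pairing flat elements with the holonomic dual *)

Section Pairing.
Context (K : fieldType) (n : nat).
Local Notation W := (weyl K n).
Local Notation x_ := (@weyl_x K n).
Local Notation d_ := (@weyl_d K n).
Local Notation const := (@weyl_const K n).

Lemma transpM (P Q : W) :
  (transp (P * Q) : W) = (transp Q : W) * (transp P : W).
Proof. by rewrite rmorphM. Qed.

Let T : {rmorphism W -> W^c} := @transp K n.

Lemma transpK (P : W) : transp (transp P : W) = P.
Proof.
have TK (Q R : W) : transp (transp Q : W) = Q -> transp (transp R : W) = R ->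
    transp (transp (Q * R) : W) = Q * R.
  by move=> QK RK; rewrite !transpM QK RK.
elim/weyl_gen_ind: P => [|P Q IHP IHQ|c P IH|i P IH|i P IH].
- have T1 : (transp 1 : W) = 1 by exact: (rmorph1 T).
  by rewrite !T1.
- have TD (R S : W) : (transp (R + S) : W) = (transp R : W) + (transp S : W).
    exact: (rmorphD T).
  by rewrite !TD IHP IHQ.
- by apply: TK => //; rewrite !transp_const.
- by apply: TK => //; rewrite !transp_x.
- apply: TK => //; rewrite transp_d.
  have TN (R : W) : (transp (- R) : W) = - (transp R : W).
    exact: (rmorphN T).
  by rewrite TN transp_d opprK.
Qed.

(** [P] modulo the right ideal generated by the partials; transposition
    identifies that quotient with the polynomial module. *)
Definition residue (P : W) : {mpoly K[n]} := act (transp P : W) 1.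

Lemma residueM P Q : residue (P * Q) = act (transp Q : W) (residue P).
Proof. by rewrite /residue transpM actM. Qed.

Lemma residueB : zmod_morphism residue.
Proof.
by move=> P Q; rewrite /residue rmorphB -[LHS]/(act_on _ _) raddfB.
Qed.
HB.instance Definition _ := GRing.isZmodMorphism.Build W {mpoly K[n]}
  residue residueB.

Lemma residueD P Q : residue (P + Q) = residue P + residue Q.
Proof. exact: raddfD. Qed.

Lemma residue_const c : residue (const c) = c%:MP.
Proof. by rewrite /residue transp_const act_const -mul_mpolyC mulr1. Qed.

Lemma residue_d i P : residue (d_ i * P) = 0.
Proof.
rewrite residueM /residue transp_d -[act _ 1]/(act_on 1 _) raddfN.
by rewrite /= /act_on act_d mderivC oppr0 linear0.
Qed.

Lemma residue_kdiff (b : seq 'I_n -> W^o) l : residue (kdiff d_ b l) = 0.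
Proof.
elim: l b => [|m l IH] b; first exact: raddf0.
by rewrite [kdiff _ _ _]/= raddfB /= IH subr0; exact: residue_d.
Qed.

Context (N : lmodType W).
Local Notation cocycle := (cocycle (free_resolution N) n).

(** The map from the dual to the polynomials attached to the flat element [v],
    on cocycles. *)
Definition flat_pairing (v : N) l (z : cocycle) : {mpoly K[n]} :=
  residue ((lker_val z : {linear free_res_obj N n -> W^o})
             (koszul_lift d_ v n l) : W).

Lemma flat_pairingD v l (y z : cocycle) :
  flat_pairing v l (y + z) = flat_pairing v l y + flat_pairing v l z.
Proof. by rewrite /flat_pairing -raddfD. Qed.

Lemma flat_pairingB v l (y z : cocycle) :
  flat_pairing v l (y - z) = flat_pairing v l y - flat_pairing v l z.
Proof. by rewrite /flat_pairing -raddfB. Qed.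

Lemma flat_pairingZ v l (a : W^c) (z : cocycle) :
  flat_pairing v l (a *: z) = act (transp (a : W) : W) (flat_pairing v l z).
Proof. by rewrite /flat_pairing -residueM. Qed.

(** A coboundary takes on a Koszul lift the value of a Koszul boundary, which
    lies in the right ideal generated by the partials. *)
Lemma coboundary_residue v l p (z : Defs.cocycle (free_resolution N) p) :
    (0 < p)%N -> (forall i, d_ i *: v = 0) -> coboundary z ->
  residue ((lker_val z : {linear free_res_obj N p -> W^o})
             (koszul_lift d_ v p l) : W) = 0.
Proof.
case: p z => // p z _ v0 [h ->].
have dd i j : d_ i * d_ j = d_ j * d_ i by exact: weyl_ddC.
rewrite -[X in residue X]/(h (free_res_diff N p (koszul_lift d_ v p.+1 l))).
by rewrite koszul_liftP // kdiff_linear residue_kdiff.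
Qed.

Lemma flat_pairing_spanned v l (z : cocycle) :
    (0 < n)%N -> (forall i, d_ i *: v = 0) ->
  spanned (@coboundary _ _ _ _) z -> flat_pairing v l z = 0.
Proof.
move=> n0 v0; elim=> [|a y w Sy _ IH].
  by rewrite /flat_pairing; exact: raddf0.
rewrite flat_pairingD flat_pairingZ IH [flat_pairing _ _ y]coboundary_residue //.
by rewrite linear0 addr0.
Qed.

Lemma cocycle_of (z : {linear free_res_obj N n -> W^o}) :
    (forall h, z (free_res_diff N n h) = 0) ->
  exists zc : cocycle, forall v l,
    flat_pairing v l zc = residue (z (koszul_lift d_ v n l) : W).
Proof.
move=> zd; have zI : (z : rdual (res_obj (free_resolution N) n)) \in
    lker_pred [the {linear rdual (res_obj (free_resolution N) n) ->
                           rdual (res_obj (free_resolution N) n.+1)} of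
                 rdual_map (res_diff (free_resolution N) n)].
  by apply/eqP; apply: rdualP => h; exact: zd.
by exists (LKer zI).
Qed.

(** The three values form a triangular matrix, so the pairings with [v1] and
    [v2] are independent maps from the dual to the polynomials.  Under an
    isomorphism with [gkz B beta] both would be determined by polynomial
    solutions of the latter, hence be proportional. *)
Lemma dual_not_gkz (v1 v2 : N) l1 l2 (z1 z2 : cocycle) (c1 c2 : K) :
    [pchar K] =i pred0 -> (0 < n)%N ->
    (forall i, d_ i *: v1 = 0) -> (forall i, d_ i *: v2 = 0) ->
    c1 != 0 -> c2 != 0 ->
    flat_pairing v1 l1 z1 = c1%:MP -> flat_pairing v2 l2 z1 = 0 ->
    flat_pairing v2 l2 z2 = c2%:MP ->
  forall d (B : 'M[int]_(d, n)) beta,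
    ~ lmod_iso (holonomic_dual N) (gkz B beta).
Proof.
move=> K0 n0 v10 v20 c10 c20 z11 z12 z22 d B beta [f [g fK gK]].
(* the cyclic generator of the GKZ-system generates the dual as well *)
pose one : gkz B beta := \pi_(gkz B beta) (1 : W^o).
pose z0 : cocycle := repr (g one : Ext N n).
have relE (P : W) : P *: g one = \pi_(Ext N n) ((transp P : W^c) *: z0).
  by rewrite -lquot_scaleE reprK.
have genE (P : W) : P *: one = \pi_(gkz B beta) (P : W^o).
  by rewrite lquot_scaleE -[_ *: _]/(P * 1) mulr1.
have pairE v l (P : W) z : (forall i, d_ i *: v = 0) ->
    f (\pi_(Ext N n) z) = P *: one ->
    flat_pairing v l z = act P (flat_pairing v l z0).
  move=> v0 fz.
  have zz0 : \pi_(Ext N n) z = \pi_(Ext N n) ((transp P : W^c) *: z0).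
    rewrite -relE; apply: (can_inj fK); rewrite fz linearZ /=; congr (_ *: _).
    by rewrite gK.
  have /lquot_eq0/flat_pairing_spanned : \pi_(Ext N n)
      (z - (transp P : W^c) *: z0) = 0 by rewrite raddfB /= zz0 subrr.
  move=> /(_ v l n0 v0); rewrite flat_pairingB flat_pairingZ transpK.
  exact: subr0_eq.
have sol v l : (forall i, d_ i *: v = 0) ->
    gkz_solution B beta (flat_pairing v l z0).
  move=> v0 P BP; rewrite -(pairE v l P 0 v0); last first.
    rewrite raddf0 linear0 genE; apply/esym/lquot_eq0.
    exact: spanned_gen.
  by rewrite /flat_pairing; exact: raddf0.
have [[a1 a2] /= [a0 aE]] :=
  gkz_solution_unique K0 (sol _ l1 v10) (sol _ l2 v20).
have comb z : a1 *: flat_pairing v1 l1 z + a2 *: flat_pairing v2 l2 z = 0.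
  pose P : W := repr (f (\pi_(Ext N n) z)).
  have fz : f (\pi_(Ext N n) z) = P *: one by rewrite genE reprK.
  rewrite (pairE _ l1 _ _ v10 fz) (pairE _ l2 _ _ v20 fz).
  transitivity (act P (a1 *: flat_pairing v1 l1 z0 +
                       a2 *: flat_pairing v2 l2 z0)).
    by rewrite linearD !linearZ.
  by rewrite aE linear0.
move: (comb z1); rewrite z11 z12 scaler0 addr0 -mul_mpolyC -mpolyCM.
move/eqP; rewrite mpolyC_eq0 mulf_eq0 (negbTE c10) orbF => /eqP a10.
move: (comb z2); rewrite a10 scale0r add0r z22 -mul_mpolyC -mpolyCM.
move/eqP; rewrite mpolyC_eq0 mulf_eq0 (negbTE c20) orbF => /eqP a20.
by rewrite a10 a20 eqxx in a0.
Qed.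
End Pairing.

Section LaurentCocycle.
Context (K : fieldType) (d n : nat) (A : 'M[int]_(d, n)) (beta : 'cV[K]_d).
Local Notation W := (weyl K n).
Local Notation x_ := (@weyl_x K n).
Local Notation d_ := (@weyl_d K n).
Local Notation const := (@weyl_const K n).
Hypothesis K0 : [pchar K] =i pred0.

(** Differentiating [x_f^2/x_e] by [d^k] gives zero unless [k] is supported on
    [e, f] with [k f <= 2]; as these exponents are alone in their fibres, they
    do not occur in toric polynomials, so [x_f^2/x_e] is a solution of the
    system.  In [v_r] only the term [a_re x_e d_f^2] acts nontrivially on it,
    with value [2 a_re]. *)
Lemma laurent_cocycle (A' : 'I_d -> 'I_n -> nat) e f (ks : seq 'I_n)
    (m : 'I_n -> 'X_{1..n}) :
    e != f -> uniq (e :: ks) -> e :: ks =i predT ->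
    (forall i j, A i j = (A' i j)%:Z) ->
    (forall r, beta r 0 = (A r f *+ 2 - A r e)%:~R) ->
    (forall k k' : 'X_{1..n}, (forall j, j != e -> j != f -> k j = 0%N) ->
       (k f <= 2)%N -> toric_degree A k' =1 toric_degree A k -> k' = k) ->
    (forall i r, toric_degree A (m i) r = A r i + (A r f *+ 2 - A r e)) ->
    m e = (U_(f) + U_(f))%MM ->
    (forall j, j != e -> exists k, [/\ k != e, k != f & (0 < m j k)%N]) ->
  exists z : {linear free_res_obj (gkz A beta) n -> W^o},
    (forall h, z (free_res_diff (gkz A beta) n h) = 0) /\
    forall r, exists b : seq 'I_n -> W^o, forall l,
      (z (koszul_lift d_
            (\pi_(gkz A beta) (euler_class K A m r : W^o)) n l) : W) =
      const (A r e *+ 2)%:~R * orient (e :: ks) (fun=> 1) l + kdiff d_ b l.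
Proof.
move=> ef uks eks AA' betaE fib mdeg me mj.
pose q := x_ f * x_ f.
pose s : seq W := d_ e * x_ e :: map d_ ks.
have rel P : gkz_relation A beta P -> lideal s ((P : W) * q).
  case=> {P} [p pI|r].
    rewrite /diff_op /mmap mulr_suml big_seq; apply: lideal_sum.
    move=> k kp; rewrite -mulrA; apply: lidealM.
    have [/existsP[j /and3P[je jf kj]]|] :=
      boolP [exists j, [&& j != e, j != f & (0 < k j)%N]].
      exact: (laurent_dmon_other K eks je jf kj).
    rewrite negb_exists => /forallP kj.
    have [kf|kf] := ltnP 2 (k f); first exact: laurent_dmon_cube.
    move: kp; rewrite mcoeff_msupp (toric_ideal_coef AA' pI) ?eqxx // => k'.
    apply: fib => // j je jf; apply/eqP; move: (kj j).
    by rewrite je jf /= lt0n negbK.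
  rewrite mulrBl betaE rmorph_int; exact: laurent_euler.
have [H [Hd HP]] := cyclic_cochain rel.
have [z [zd zP]] := koszul_cocycle K0 uks eks Hd.
exists z; split=> // r.
apply: zP => [i|].
  exact: (euler_class_flat (b := fun r => A r f *+ 2 - A r e)).
apply: HP.
rewrite rmorph_int mulr_suml (bigD1 e) //= addrAC.
apply: lidealD; last first.
  apply: lideal_sum => j je; rewrite -(mulrA _ (dmon K (m j)) q).
  apply: lidealM.
  have [k [ke kf kj]] := mj j je. exact: (laurent_dmon_other K eks ke kf kj).
have -> : (A r e *+ 2)%:~R * x_ e = (A r e)%:~R * x_ e * 2%:R :> W.
  by rewrite -mulrA commr_nat mulrA mulr_natr !mulr2n intrD.
rewrite -[_ * _ * q]mulrA -mulrBr me dmonD dmonU -mulrA.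
by apply: lidealM; exact: laurent_dd_q.
Qed.
End LaurentCocycle.

(** * The matrix with columns (1,0), (1,1), (1,3), (1,4) *)

Section A0134.

Definition A0134 : 'M[int]_(2, 4) := \matrix_(i < 2, j < 4)
    nth 0 (nth [::] [:: [:: 1; 1; 1; 1]; [:: 0; 1; 3; 4]] i) j.

Let o0 : 'I_4 := @Ordinal 4 0 isT.
Let o1 : 'I_4 := @Ordinal 4 1 isT.
Let o2 : 'I_4 := @Ordinal 4 2 isT.
Let o3 : 'I_4 := @Ordinal 4 3 isT.

Lemma ord4P (P : 'I_4 -> Prop) : P o0 -> P o1 -> P o2 -> P o3 -> forall i, P i.
Proof.
move=> P0 P1 P2 P3 [[|[|[|[|//]]]] i4].
- by rewrite (_ : Ordinal i4 = o0) //; apply: val_inj.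
- by rewrite (_ : Ordinal i4 = o1) //; apply: val_inj.
- by rewrite (_ : Ordinal i4 = o2) //; apply: val_inj.
- by rewrite (_ : Ordinal i4 = o3) //; apply: val_inj.
Qed.

Lemma ord2P (P : 'I_2 -> Prop) : P ord0 -> P ord_max -> forall i, P i.
Proof.
move=> P0 P1 [[|[|//]] i2].
- by rewrite (_ : Ordinal i2 = ord0) //; apply: val_inj.
- by rewrite (_ : Ordinal i2 = ord_max) //; apply: val_inj.
Qed.

Lemma sum_ord4 (F : 'I_4 -> int) : \sum_j F j = F o0 + F o1 + F o2 + F o3.
Proof.
rewrite 4!big_ord_recl big_ord0 addr0 !addrA.
by congr (F _ + F _ + F _ + F _); apply: val_inj.
Qed.

Lemma A0134E0 j : A0134 ord0 j = 1.
Proof. by rewrite mxE; elim/ord4P: j. Qed.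

Lemma A0134E1 j : A0134 ord_max j = nth 0 [:: 0; 1; 3; 4] j.
Proof. by rewrite mxE. Qed.

Lemma toric_degree0 m :
  toric_degree A0134 m ord0 = (m o0 + m o1 + m o2 + m o3)%N%:Z.
Proof.
by rewrite /toric_degree sum_ord4 !A0134E0 !mul1r !PoszD.
Qed.

Lemma toric_degree1 m :
  toric_degree A0134 m ord_max = (m o1 + 3 * m o2 + 4 * m o3)%N%:Z.
Proof.
rewrite /toric_degree sum_ord4 !A0134E1 /= mul0r add0r mul1r. lia.
Qed.

Definition m0134 (i : 'I_4) : 'X_{1..4} := nth 0%MM
  [:: U_(o1) + U_(o1); U_(o0) + U_(o2); U_(o1) + U_(o3); U_(o2) + U_(o2)]%MM i.

Definition A0134_nat (r : 'I_2) (j : 'I_4) : nat :=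
  nth 0%N (nth [::] [:: [:: 1; 1; 1; 1]; [:: 0; 1; 3; 4]]%N r) j.

Lemma A0134_natE i j : A0134 i j = (A0134_nat i j)%:Z.
Proof. by rewrite mxE; elim/ord2P: i; elim/ord4P: j. Qed.

Lemma m0134_degree i r :
  toric_degree A0134 (m0134 i) r = A0134 r i + nth 0 [:: 1; 2] r.
Proof.
elim/ord2P: r; rewrite (toric_degree0, toric_degree1) (A0134E0, A0134E1).
  by elim/ord4P: i; rewrite /m0134 /= !mnmDE !mnm1E.
by elim/ord4P: i; rewrite /m0134 /= !mnmDE !mnm1E.
Qed.

Lemma A0134_eq_degree (k k' : 'X_{1..4}) :
    toric_degree A0134 k' =1 toric_degree A0134 k ->
  (k' o0 + k' o1 + k' o2 + k' o3 = k o0 + k o1 + k o2 + k o3 /\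
   k' o1 + 3 * k' o2 + 4 * k' o3 = k o1 + 3 * k o2 + 4 * k o3)%N.
Proof.
move=> kk'; have := kk' ord0; have := kk' ord_max.
by rewrite !toric_degree0 !toric_degree1 => -[->] [->].
Qed.

(** The second degree of [k] is at most 2, while the last two columns have
    second entries 3 and 4. *)
Lemma A0134_fibre01 (k k' : 'X_{1..4}) :
    (forall j, j != o0 -> j != o1 -> k j = 0%N) -> (k o1 <= 2)%N ->
  toric_degree A0134 k' =1 toric_degree A0134 k -> k' = k.
Proof.
move=> k0 k1 /A0134_eq_degree[]; have := k0 o2 isT isT; have := k0 o3 isT isT.
move=> k3 k2 e0 e1; apply/mnmP; elim/ord4P; lia.
Qed.

(** The mirror image of [A0134_fibre01]: replacing the second row by four times
    the first minus the second reverses the order of the columns. *)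
Lemma A0134_fibre32 (k k' : 'X_{1..4}) :
    (forall j, j != o3 -> j != o2 -> k j = 0%N) -> (k o2 <= 2)%N ->
  toric_degree A0134 k' =1 toric_degree A0134 k -> k' = k.
Proof.
move=> k0 k1 /A0134_eq_degree[]; have := k0 o0 isT isT; have := k0 o1 isT isT.
move=> k3 k2 e0 e1; apply/mnmP; elim/ord4P; lia.
Qed.

Lemma dual_gkz0134_not_gkz (K : fieldType) : [pchar K] =i pred0 ->
  let beta : 'cV[K]_2 := \col_(i < 2) nth 0 [:: 1; 2] i in
  forall d (B : 'M[int]_(d, 4)) (beta' : 'cV[K]_d),
    ~ lmod_iso (holonomic_dual (gkz A0134 beta)) (gkz B beta').
Proof.
move=> K0 beta d B beta'.
have betaE r : beta r 0 = (nth 0 [:: 1; 2] r : int)%:~R.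
  by rewrite mxE; elim/ord2P: r.
have b01 r : A0134 r o1 *+ 2 - A0134 r o0 = nth 0 [:: 1; 2] r.
  by elim/ord2P: r; rewrite !(A0134E0, A0134E1).
have b32 r : A0134 r o2 *+ 2 - A0134 r o3 = nth 0 [:: 1; 2] r.
  by elim/ord2P: r; rewrite !(A0134E0, A0134E1).
have [|||||||||z1 [z1d z1P]] := @laurent_cocycle K 2 4 A0134 beta K0
  A0134_nat o0 o1 [:: o1; o2; o3] m0134.
- by [].
- by [].
- by elim/ord4P.
- exact: A0134_natE.
- by move=> r; rewrite b01 betaE.
- exact: A0134_fibre01.
- by move=> i r; rewrite b01 m0134_degree.
- by [].
- elim/ord4P => // _.
  + by exists o2; rewrite /m0134 /= mnmDE !mnm1E.
  + by exists o3; rewrite /m0134 /= mnmDE !mnm1E.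
  + by exists o2; rewrite /m0134 /= mnmDE !mnm1E.
have [|||||||||z2 [z2d z2P]] := @laurent_cocycle K 2 4 A0134 beta K0
  A0134_nat o3 o2 [:: o0; o1; o2] m0134.
- by [].
- by [].
- by elim/ord4P.
- exact: A0134_natE.
- by move=> r; rewrite b32 betaE.
- exact: A0134_fibre32.
- by move=> i r; rewrite b32 m0134_degree.
- by [].
- elim/ord4P => // _.
  + by exists o1; rewrite /m0134 /= mnmDE !mnm1E.
  + by exists o0; rewrite /m0134 /= mnmDE !mnm1E.
  + by exists o1; rewrite /m0134 /= mnmDE !mnm1E.
pose v r : gkz A0134 beta :=
  \pi_(gkz A0134 beta) (euler_class K A0134 m0134 r : (weyl K 4)^o).
have v0 r i : weyl_d K i *: v r = 0.
  by apply: (euler_class_flat (b := fun r : 'I_2 => nth 0 [:: 1; 2] r)) => // *;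
    exact: m0134_degree.
have [c1 c1E] := cocycle_of z1d; have [c2 c2E] := cocycle_of z2d.
have char m : (m.+1%:~R : K) != 0.
  by rewrite -pmulrn; have /pcharf0P-> := K0.
apply: (@dual_not_gkz K 4 _ (v ord0) (v ord_max) [:: o3; o2; o1; o0]
  [:: o2; o1; o0; o3] c1 c2 2%:~R 8%:~R) => //; try exact: v0.
- exact: (char 1%N).
- exact: (char 7%N).
- have [b bE] := z1P ord0; rewrite c1E bE residueD residue_kdiff addr0.
  rewrite -[X in orient _ _ X]cats0 (@orient_rev _ _ [:: o0; o1; o2; o3]) //.
  by rewrite mulr1 residue_const A0134E0.
- have [b bE] := z1P ord_max; rewrite c1E bE residueD residue_kdiff addr0.
  by rewrite A0134E1 rmorph0 mul0r raddf0.
- have [b bE] := z2P ord_max; rewrite c2E bE residueD residue_kdiff addr0.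
  rewrite -[X in orient _ _ X]cats0 (@orient_rev _ _ [:: o3; o0; o1; o2]) //.
  by rewrite mulr1 residue_const A0134E1.
Qed.
End A0134.

Theorem proposition4p6 (R : realType) :
  let A : 'M[int]_(2, 4) := \matrix_(i < 2, j < 4)
    nth 0 (nth [::] [:: [:: 1; 1; 1; 1]; [:: 0; 1; 3; 4]] i) j in
  let beta : 'cV[R[i]]_2 := \col_(i < 2) nth 0 [:: 1; 2] i in
  let M := holonomic_dual (gkz A beta) in
  forall (d : nat) (B : 'M[int]_(d, 4)) (beta' : 'cV[R[i]]_d),
    gkz_matrix B -> ~ lmod_iso M (gkz B beta').
Proof.
move=> A beta M d B beta' _; apply: dual_gkz0134_not_gkz.
exact: Num.Theory.pchar_num.
Qed.
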